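(* Let $T$ be a subcubic subdivided caterpillar and let $\Delta>0$ be an integer. Then there exist integers $k,t$ such that for every graph $G$ of maximum degree at most $\Delta$, if $G$ contains a $(k,t)$-creature, then $G$ contains an induced subgraph isomorphic to a subdivision of $T$ or to the line graph of a subdivision of $T$.
   Context: A tree $T$ is a subdivided caterpillar if some path in $T$ contains all vertices of degree at least three; subcubic means maximum degree at most three. Subdivision replaces edges by paths; the line graph $L(F)$ has vertex set $E(F)$, adjacency = sharing an end. For integers $k>0$, $t\ge0$, a $(k,t)$-creature in $G$ is a pair $(J,\mathcal{P})$ with $J\subseteq V(G)$ connected, $\mathcal{P}$ a collection of $k$ pairwise vertex-disjoint, pairwise anticomplete induced paths in $G\setminus J$ each of length $t$ (number of edges), such that for each $P\in\mathcal{P}$ some end $v$ of $P$ has a neighbour in $J$ and $V(P)\setminus\{v\}$ is anticomplete to $J$. *)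

(* Defs.v *)
From mathcomp Require Import all_boot.

Set Implicit Arguments.
Unset Strict Implicit.
Unset Printing Implicit Defensive.

Record sgraph := SGraph {
  vertex :> finType;
  adj : rel vertex;
  adj_sym : symmetric adj;
  adj_irr : irreflexive adj
}.

Definition degree (G : sgraph) (x : G) : nat := #|[set y | adj x y]|.

Definition max_degree_le (G : sgraph) (d : nat) : Prop :=
  forall x : G, degree x <= d.

Definition iso (G H : sgraph) : Prop :=
  exists2 f : G -> H, bijective f & forall x y, adj (f x) (f y) = adj x y.

Definition connected (G : sgraph) : Prop :=
  0 < #|G| /\ forall x y : G, connect (@adj G) x y.

Definition acyclic (G : sgraph) : Prop :=
  forall c : seq G, 2 < size c -> ~ ucycle (@adj G) c.

Definition tree (G : sgraph) : Prop := connected G /\ acyclic G.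

Definition induced_adj (G : sgraph) (S : {set G}) : rel {x : G | x \in S} :=
  fun x y => adj (val x) (val y).

Lemma induced_sym (G : sgraph) (S : {set G}) : symmetric (@induced_adj G S).
Proof. by move=> x y; apply: adj_sym. Qed.

Lemma induced_irr (G : sgraph) (S : {set G}) : irreflexive (@induced_adj G S).
Proof. by move=> x; apply: adj_irr. Qed.

Definition induced (G : sgraph) (S : {set G}) : sgraph :=
  SGraph (@induced_sym G S) (@induced_irr G S).

Definition edges (G : sgraph) : {set {set G}} :=
  [set [set p.1; p.2] | p : G * G & adj p.1 p.2].

Definition line_adj (G : sgraph) : rel {A : {set G} | A \in edges G} :=
  fun A B => (A != B) && (val A :&: val B != set0).

Lemma line_sym (G : sgraph) : symmetric (@line_adj G).
Proof. by move=> A B; rewrite /line_adj eq_sym setIC. Qed.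

Lemma line_irr (G : sgraph) : irreflexive (@line_adj G).
Proof. by move=> A; rewrite /line_adj eqxx. Qed.

Definition line_graph (G : sgraph) : sgraph :=
  SGraph (@line_sym G) (@line_irr G).

(* A path is given by its sequence of vertices; its length (number of edges)
   is one less than the size of that sequence. *)
Definition is_path (G : sgraph) (s : seq G) : Prop :=
  [/\ s != [::], uniq s & sorted (@adj G) s].

Definition consec (T : eqType) (s : seq T) (u v : T) : bool :=
  (u, v) \in zip s (behead s).

Definition is_induced_path (G : sgraph) (s : seq G) : Prop :=
  is_path s /\
  {in s &, forall u v, adj u v -> consec s u v \/ consec s v u}.

Definition path_end (G : sgraph) (s : seq G) (v : G) : Prop :=
  (exists s', s = v :: s') \/ (exists s', s = rcons s' v).

Definition anticomplete (G : sgraph) (A B : {set G}) : Prop :=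
  {in A & B, forall x y, ~~ adj x y}.

Definition subdivided_caterpillar (T : sgraph) : Prop :=
  tree T /\
  exists2 s : seq T, is_path s & forall x : T, 3 <= degree x -> x \in s.

Definition subcubic (T : sgraph) : Prop := max_degree_le T 3.

(* [F] is obtained from [H] by replacing each edge [x y] by a path from [f x]
   to [f y] with interior [I x y]; the interior may be empty, in which case the
   edge is kept. The values of [I] on non-adjacent pairs are irrelevant. *)
Definition subdivision (H F : sgraph) : Prop :=
  exists (f : H -> F) (I : H -> H -> seq F),
    let P x y := f x :: rcons (I x y) (f y) in
    [/\ injective f,
        forall x y, adj x y -> is_path (P x y) /\ I y x = rev (I x y),
        forall x y z, adj x y -> f z \notin I x y,
        forall x y x' y' u, adj x y -> adj x' y' ->
          u \in I x y -> u \in I x' y' -> [set x; y] = [set x'; y']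
      & (forall u, (exists x, u = f x) \/
                   (exists x y, adj x y /\ u \in I x y)) /\
        (forall u v, adj u v -> exists x y, adj x y /\ consec (P x y) u v)].

Definition creature (G : sgraph) (k t : nat) (J : {set G})
    (P : 'I_k -> seq G) : Prop :=
  connected (induced J) /\
  [/\ forall i, is_induced_path (P i) /\ size (P i) = t.+1,
      forall i, [disjoint [set x in P i] & J],
      forall i j, i != j -> [disjoint [set x in P i] & [set x in P j]],
      forall i j, i != j -> anticomplete [set x in P i] [set x in P j]
    & forall i, exists v : G,
        [/\ path_end (P i) v, exists2 y, y \in J & adj v y
          & anticomplete ([set x in P i] :\ v) J]].

Definition contains_creature (G : sgraph) (k t : nat) : Prop :=
  exists (J : {set G}) (P : 'I_k -> seq G), creature t J P.

Definition contains_induced (G H : sgraph) : Prop :=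
  exists S : {set G}, iso (induced S) H.

(* Main.v *)
Require Import Defs.
From mathcomp Require Import all_boot zify.

(* A bounded-degree connected graph [J] carrying many long legs contains a
   long comb.  Let [X] be the set of ends of the legs attached to [J] and [H] a
   minimal connected set with [X <= H <= J + X].  In the breadth-first levels of
   [H] from a root, each branching divides the number of reachable members of
   [X] by at most [Delta + 1], so some geodesic [p] has many events: a vertex
   [p_x] in [X], or a child [w] of [p_x] other than [p_(x+1)].  By minimality of
   [H], removing such a [w] cuts a member of [X] off from [p], so [w] carries a
   private part of [H] plus legs that contains a whole leg, hence an induced path
   of any prescribed length.  The neighbours of [w] on [p] lie in
   [{p_x, p_(x+1), p_(x+2)}].  If [p_(x+2)] is one of them, rerouting [p] through
   [w] makes [w] the centre of a claw; otherwise the attachment is a claw at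
   [p_x] or a triangle.  Pigeonhole yields many events of a single kind, far
   apart, which gives an induced comb, or the line graph of a comb.  A subcubic
   subdivided caterpillar is itself a comb, and only its spine needs
   subdividing. *)

Set Implicit Arguments.
Unset Strict Implicit.
Unset Printing Implicit Defensive.

(** * Coordinates of a subcubic subdivided caterpillar *)

(** A pair is a position on the spine followed by a height in the tooth there; height 0 is the spine
    itself. *)
Definition comb_adj (p q : nat * nat) : bool :=
  [&& p.2 == 0, q.2 == 0 & (p.1 == q.1.+1) || (q.1 == p.1.+1)] ||
  (p.1 == q.1) && ((p.2 == q.2.+1) || (q.2 == p.2.+1)).

Lemma comb_adj_sym : symmetric comb_adj.
Proof. by move=> [a b] [c d]; rewrite /comb_adj /=; lia. Qed.

Lemma comb_adj_irr : irreflexive comb_adj.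
Proof. by move=> [a b]; rewrite /comb_adj /=; lia. Qed.

(** [comb_hom] goes one way only; the converse will follow from acyclicity once [B] is everything.
    [comb_deg] keeps every branch vertex of [T] on the spine, which limits where the comb can
    grow. *)
Record comb_part (T : sgraph) (B : {set T}) (co : T -> nat * nat) (N : nat)
    (h : nat -> nat) : Prop := CombPart {
  comb_inj : {in B &, injective co};
  comb_dom : {in B, forall x, (co x).1 <= N /\ (co x).2 <= h (co x).1};
  comb_surj : forall i j, i <= N -> j <= h i ->
    exists2 x, x \in B & co x = (i, j);
  comb_hom : {in B &, forall x y, comb_adj (co x) (co y) -> adj x y};
  comb_deg : forall x, 3 <= degree x -> x \in B /\ (co x).2 = 0 }.

Lemma size_le_degree (T : sgraph) (x : T) (s : seq T) :
  uniq s -> all (adj x) s -> size s <= degree x.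
Proof.
move=> us /allP sa; rewrite -(card_uniqP us); apply: subset_leq_card.
by apply/subsetP => y /sa; rewrite inE.
Qed.

(** Prepending to the spine, appending to it and lengthening a tooth all attach one new vertex by a
    single comb edge. What they share is proved here, which leaves arithmetic on coordinates. *)
Lemma comb_part_extend (T : sgraph) (B B' : {set T}) (y : T) co co' N N' h h' x :
  comb_part B co N h -> y \notin B -> x \in B -> adj x y ->
  B' = y |: B ->
  (forall z, z \in B -> (co' z).1 <= N' /\ (co' z).2 <= h' (co' z).1) ->
  (co' y).1 <= N' /\ (co' y).2 <= h' (co' y).1 ->
  (forall i j, i <= N' -> j <= h' i -> (i, j) = co' y \/
    exists i' j', [/\ i' <= N, j' <= h i' &
      forall z, z \in B -> co z = (i', j') -> co' z = (i, j)]) ->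
  {in B &, forall z z', co' z = co' z' -> co z = co z'} ->
  {in B, forall z, co' z <> co' y} ->
  {in B &, forall z z', comb_adj (co' z) (co' z') -> comb_adj (co z) (co z')} ->
  {in B, forall z, comb_adj (co' z) (co' y) -> co z = co x} ->
  {in B, forall z, (co' z).2 = (co z).2} ->
  comb_part B' co' N' h'.
Proof.
move=> [ci cd cs ch cg] yB xB axy -> Hd Hy Hs Hi Hiy Hh Hhy H2.
split.
- move=> z z' /setU1P[->|zB] /setU1P[->|zB'] // E.
  + by case: (Hiy _ zB').
  + by case: (Hiy _ zB).
  + by apply: ci => //; apply: Hi.
- by move=> z /setU1P[->|/Hd].
- move=> i j iN jh; case: (Hs i j iN jh) => [E|[i' [j' [i'N j'h E]]]].
    by exists y => //; rewrite setU11.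
  have [z zB zE] := cs _ _ i'N j'h; exists z; last exact: E.
  by rewrite setU1r.
- move=> z z' /setU1P[->|zB] /setU1P[->|zB'].
  + by rewrite comb_adj_irr.
  + by rewrite comb_adj_sym => /(Hhy _ zB')/(ci _ _ zB' xB)->; rewrite adj_sym.
  + by move=> /(Hhy _ zB)/(ci _ _ zB xB)->.
  + by move=> /(Hh _ _ zB zB'); apply: ch.
- by move=> z /cg [zB E]; rewrite setU1r // H2.
Qed.

(** If [x] is the tip of its tooth, possibly of height 0, the tooth grows. Otherwise [x] must be an
    end of the spine, which is extended beyond [x]; any other place violates a degree condition. *)
Lemma comb_part_grow (T : sgraph) (B : {set T}) co N h x y :
  subcubic T -> comb_part B co N h -> y \notin B -> x \in B -> adj x y ->
  exists co' N' h', comb_part (y |: B) co' N' h'.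
Proof.
move=> sT cB yB xB axy; have [ci cd cs ch cg] := cB.
case E: (co x) => [i j].
have [/= iN jh] := cd _ xB; rewrite E /= in iN jh.
have zy z : z \in B -> (z == y) = false.
  by move=> zB; apply: contraNF yB => /eqP <-.
have nb k l : k <= N -> l <= h k -> comb_adj (k, l) (i, j) ->
    exists2 z, z \in B /\ co z = (k, l) & adj x z.
  move=> kN lh a; have [z zB zE] := cs _ _ kN lh; exists z => //.
  by rewrite adj_sym; apply: ch => //; rewrite E zE.
have degy (s : seq T) : uniq s -> all (adj x) s -> all (mem B) s ->
    (size s).+1 <= degree x.
  move=> us sa sB; apply: (@size_le_degree _ _ (y :: s)) => /=; last first.
    by rewrite axy.
  by rewrite us andbT; apply: contra yB => /(allP sB).
have ext co' N' h' := @comb_part_extend _ _ _ y co co' N N' h h' x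
  cB yB xB axy erefl.
have [jE|jh'] := eqVneq j (h i); last first.
  have ltjh : j < h i by lia.
  have [|j0] := posnP j.
    move=> j0; have [i0|i0] := posnP i.
      (* The new vertex becomes position 0, so every other position moves right by one. *)
      exists (fun z => if z == y then (0, 0) else ((co z).1.+1, (co z).2)), N.+1,
        (fun i => if i is i'.+1 then h i' else 0).
      apply: ext.
      - by move=> z zB; rewrite zy //=; have := cd _ zB; lia.
      - by rewrite eqxx.
      - move=> [|i'] j' /= i'N j'h; rewrite eqxx; [left|right].
          by congr pair; lia.
        exists i', j'; split=> //; move=> z zB zE.
        by rewrite zy // zE.
      - move=> z z' zB zB'; rewrite !zy //.
        by case: (co z) (co z') => [? ?] [? ?] /= [-> ->].
      - by move=> z zB; rewrite eqxx zy.
      - by move=> z z' zB zB'; rewrite !zy // /comb_adj /=; lia.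
      - move=> z zB; rewrite eqxx zy // E /comb_adj /=.
        by case: (co z) => [? ?] /= ?; congr pair; lia.
      - by move=> z zB; rewrite zy.
    have [iE|iE] := eqVneq i N.
      exists (fun z => if z == y then (N.+1, 0) else co z), N.+1,
        (fun i => if i == N.+1 then 0 else h i).
      apply: ext.
      - move=> z zB; rewrite zy //=; have [? ?] := cd _ zB.
        by case: eqP; lia.
      - by rewrite eqxx /= eqxx.
      - move=> i' j'; rewrite eqxx; case: eqP => [-> ? ?|? ? ?].
          by left; congr pair; lia.
        right; exists i', j'; split=> //; first by lia.
        by move=> z zB zE; rewrite zy.
      - by move=> z z' zB zB'; rewrite !zy.
      - move=> z zB; rewrite eqxx zy // => H.
        by have := cd _ zB; rewrite H /=; lia.
      - by move=> z z' zB zB'; rewrite !zy.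
      - move=> z zB; rewrite eqxx zy // E /comb_adj /=.
        have := cd _ zB.
        by case: (co z) => [? ?] /= ? ?; congr pair; lia.
      - by move=> z zB; rewrite zy.
    (* An inner spine vertex with a nonempty tooth already has three comb neighbours, so [y] would
       be a fourth. *)
    have [||| z1 [z1B z1E] a1] := nb i.-1 0; rewrite /comb_adj /=; try (clear -i0 iN j0; lia).
    have [||| z2 [z2B z2E] a2] := nb i.+1 0; rewrite /comb_adj /=; try (clear -iE iN j0; lia).
    have [||| z3 [z3B z3E] a3] := nb i 1; rewrite /comb_adj /= ?eqxx ?j0 //; try (clear -j0 ltjh; lia).
    have := degy [:: z1; z2; z3]; rewrite /= a1 a2 a3 z1B z2B z3B => H.
    have {}H : 3 < degree x.
      apply: H => //; rewrite !inE !andbT negb_or; apply/andP; split.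
        apply/andP; split; apply: contraTneq isT => H'.
          by move: z2E; rewrite -H' z1E => -[E']; clear -E' i0; lia.
        by move: z3E; rewrite -H' z1E => -[].
      by apply: contraTneq isT => H'; move: z3E; rewrite -H' z2E => -[].
    by have := sT x; rewrite leqNgt H.
  (* Inside a tooth, [y] would be a third neighbour, but branch vertices lie on the spine. *)
  have [||| z1 [z1B z1E] a1] := nb i j.-1; rewrite /comb_adj /=; try lia.
  have [||| z2 [z2B z2E] a2] := nb i j.+1; rewrite /comb_adj /=; try lia.
  have := degy [:: z1; z2]; rewrite /= a1 a2 z1B z2B => H.
  have {}H : 2 < degree x.
    apply: H => //; rewrite !inE !andbT.
    by apply: contraTneq isT => H'; move: z2E; rewrite -H' z1E => -[E']; clear -E' j0; lia.
  by have [_] := cg _ H; rewrite E /= => E'; rewrite E' in j0.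
exists (fun z => if z == y then (i, j.+1) else co z), N,
  (fun k => if k == i then j.+1 else h k).
apply: ext.
- move=> z zB; rewrite zy //=; have [H1 H2] := cd _ zB.
  case: eqP => [E'|_]; split=> //; rewrite E' -jE in H2; exact: leqW.
- by rewrite eqxx /= eqxx.
- move=> i' j'; rewrite eqxx; case: eqP => [-> ? ?|? ? ?].
    have [jj|jj] := leqP j' j; last by left; congr pair; lia.
    right; exists i, j'; split=> //; first by lia.
    by move=> z zB zE; rewrite zy.
  right; exists i', j'; split=> //.
  by move=> z zB zE; rewrite zy.
- by move=> z z' zB zB'; rewrite !zy.
- move=> z zB; rewrite eqxx zy // => H.
  by have := cd _ zB; rewrite H /=; lia.
- by move=> z z' zB zB'; rewrite !zy.
- move=> z zB; rewrite eqxx zy // E /comb_adj /=.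
  have := cd _ zB.
  case: (co z) => [k l] /= [? ?] ?.
  have ? : k = i by lia.
  by subst k; congr pair; lia.
- by move=> z zB; rewrite zy.
Qed.

(** The growth starts from the path through all branch vertices, with every tooth of height 0. *)
Lemma comb_part_init (T : sgraph) : subdivided_caterpillar T ->
  exists B co N h, @comb_part T B co N h.
Proof.
move=> [_ [s [s0 us ss] sdeg]].
exists [set x in s], (fun x => (index x s, 0)), (size s).-1, (fun=> 0).
have szs : 0 < size s by case: (s) s0.
split=> /=.
- move=> x y; rewrite !inE => xs ys [E].
  by rewrite -(nth_index x xs) E nth_index.
- by move=> x; rewrite inE -index_mem => xs; rewrite -ltnS prednK.
- case: s s0 us {ss sdeg} szs => // x0 s _ us _ i j /= iN j0.
  exists (nth x0 (x0 :: s) i); first by rewrite inE mem_nth.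
  by congr pair; [exact: (index_uniq x0 (iN : i < size (x0 :: s)) us) | lia].
- move=> x y; rewrite !inE /comb_adj /= => xs ys.
  have key u v : u \in s -> v \in s -> index v s = (index u s).+1 -> adj u v.
    move=> us' vs' E; have := sortedP u ss (index u s).
    by rewrite -E index_mem !nth_index // => /(_ vs').
  rewrite andbF orbF => /orP[]/eqP E; last exact: key.
  by rewrite adj_sym; apply: key.
- by move=> x /sdeg xs; rewrite inE.
Qed.

(** Connectedness lets a partial comb grow until it covers [T]. Acyclicity then turns [comb_hom]
    into an equivalence. *)
Lemma comb_coordinates (T : sgraph) : subdivided_caterpillar T -> subcubic T ->
  exists (co : T -> nat * nat) N h,
  [/\ injective co, forall x, (co x).1 <= N /\ (co x).2 <= h (co x).1,
      forall i j, i <= N -> j <= h i -> exists x, co x = (i, j)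
    & forall x y, adj x y = comb_adj (co x) (co y)].
Proof.
move=> cT sT; have [[[_ conT] acT] _] := cT.
suff [co [N [h [ci cd cs ch cg]]]] :
    exists co N h, @comb_part T setT co N h.
  exists co, N, h.
  have ci' : injective co by move=> x y; apply: ci.
  split=> //.
  - by move=> x; apply: cd.
  - by move=> i j iN jh; have [x _ xE] := cs _ _ iN jh; exists x.
  have [r _ rE] := cs 0 0 isT isT.
  pose e : rel T := fun x y => comb_adj (co x) (co y).
  have esym : connect_sym e by apply: sym_connect_sym => x y; apply: comb_adj_sym.
  (* Descending the tooth and then walking left along the spine reaches [r], so comb edges alone
     connect [T]. *)
  have er x : connect e x r.
    have [n] := ubnP ((co x).1 + (co x).2); elim: n x => // n IH x.
    case E : (co x) => [i j] /= nij; have := cd x (in_setT _); rewrite E /= => -[iN jh].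
    have step z : e x z -> (co z).1 + (co z).2 < n -> connect e x r.
      by move=> xz /IH zr; exact: connect_trans (connect1 xz) zr.
    case: j => [|j] in E nij jh *.
      case: i => [|i] in E nij iN jh *.
        by rewrite (ci' x r) // E rE.
      have [z _ zE] := cs i 0 (ltnW iN) isT.
      by apply: (step z); rewrite /e ?E ?zE /comb_adj /=; lia.
    have [z _ zE] := cs i j iN (ltnW jh).
    by apply: (step z); rewrite /e ?E ?zE /comb_adj /=; lia.
  move=> x y; apply/idP/idP; last by apply: ch.
  move=> axy; apply: contraT => nxy.
  (* A comb path from [x] to [y] together with an edge that is not a comb edge would close a
     cycle. *)
  have /connectP[p0] : connect e x y by apply: connect_trans (er x) _; rewrite esym.
  move=> /shortenP[p pp up _] pE {p0}.
  case: (acT (x :: p)).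
    case: p => [|a [|b p]] // in pp up pE *.
      by move: axy; rewrite pE /= adj_irr.
    by move: pp nxy; rewrite pE /= andbT /e => ->.
  rewrite /ucycle up andbT /= rcons_path -pE adj_sym axy andbT.
  by apply: sub_path pp => u v; apply: ch.
have [B [co [N [h cB]]]] := comb_part_init cT.
have [n] := ubnP #|~: B|; elim: n B co N h cB => // n IH B co N h cB nB.
have [BT|] := boolP [forall y, y \in B]; last first.
  case/forallPn=> y0 y0B.
  have [x0 x0B _] : exists2 x, x \in B & co x = (0, 0) by case: cB => _ _ H _ _; apply: H.
  have [x xB [y yB axy]] : exists2 x, x \in B & exists2 y, y \notin B & adj x y.
    have /connectP[p pp pE] := conT x0 y0.
    elim: p x0 x0B pp pE => [|z p IHp] x0 x0B /=; first by move=> _ E; rewrite E x0B in y0B.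
    case/andP=> a pp pE; have [zB|zB] := boolP (z \in B); first exact: IHp pp pE.
    by exists x0 => //; exists z.
  have [co' [N' [h' cB']]] := comb_part_grow sT cB yB xB axy.
  apply: IH cB' _; rewrite -ltnS; apply: leq_trans nB; rewrite ltnS.
  by apply: proper_card; rewrite properC properUr // sub1set.

  exists co, N, h; suff <- : B = setT by [].
  by apply/setP => y; rewrite inE (forallP BT).
Qed.

(** * Stretched combs *)

Lemma contains_induced_emb (G H : sgraph) (g : H -> G) :
  injective g -> (forall x y, adj (g x) (g y) = adj x y) ->
  contains_induced G H.
Proof.
move=> gi ga; pose S := [set g x | x : H]; exists S.
have mem x : g x \in S by apply: imset_f.
have pre (u : induced S) : exists x, g x = val u.
  by case: u => u /= uS; case/imsetP: (uS) => x _ ->; exists x.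
have pick u : {x | g x = val (u : induced S)}.
  case: (pickP [pred x | g x == val u]) => [x /eqP|no]; first by exists x.
  by exfalso; case: (pre u) => x /eqP E; have := no x; rewrite /= E.
pose f u := sval (pick u); have fE u : g (f u) = val u := svalP (pick u).
exists f; last by move=> x y; rewrite -ga !fE.
exists (fun x => Sub (g x) (mem x)).
  by move=> u; apply: val_inj; rewrite /= fE.
by move=> x; apply: gi; rewrite fE.
Qed.

(* An edge of a rooted tree is identified with its lower end. *)
Lemma contains_line_graph_rooted (G F : sgraph) (par : F -> F) (r : F)
    (lvl : F -> nat) (g : F -> G) :
  (forall u, u != r -> lvl (par u) < lvl u) ->
  (forall u v, adj u v = (u != r) && (par u == v) || (v != r) && (par v == u)) ->
  (forall u v, u != r -> v != r -> g u = g v -> u = v) ->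
  (forall u v, u != r -> v != r -> adj (g u) (g v) =
     [|| par u == v, par v == u | (u != v) && (par u == par v)]) ->
  contains_induced G (line_graph F).
Proof.
move=> Hl Ha gi ga.
have edgeP (A : line_graph F) : exists u, (u != r) && (val A == [set u; par u]).
  case: A => A /= eA; case/imsetP: (eA) => -[u v] /=.
  rewrite inE /= Ha => /orP[]/andP[nr /eqP<-] ->; [exists u|exists v].
    by rewrite nr eqxx.
  by rewrite nr setUC eqxx.
pose ch A := xchoose (edgeP A).
have chr A : ch A != r by case/andP: (xchooseP (edgeP A)).
have chE A : val A = [set ch A; par (ch A)].
  by case/andP: (xchooseP (edgeP A)) => _ /eqP.
have chi : injective ch by move=> A B E; apply: val_inj; rewrite !chE E.
have npar u v : u != r -> v != r -> par u == v -> par v == u -> false.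
  move=> ur vr /eqP uv /eqP vu.
  by have := Hl _ ur; have := Hl _ vr; rewrite uv vu; lia.
apply: (@contains_induced_emb _ _ (g \o ch)) => [A B /= /gi E|A B /=].
  by apply: chi; apply: E.
rewrite ga // /line_adj -(inj_eq chi) !chE.
set u := ch A; set v := ch B.
have [->|uv] /= := eqVneq u v.
  apply/negbTE; rewrite orbF orbb; apply/eqP => E.
  by have := Hl _ (chr B); rewrite -/v E ltnn.
apply/idP/set0Pn => [|[z]].
  case/or3P=> /eqP E; [exists v|exists u|exists (par u)];
    by rewrite !inE E !eqxx ?orbT.
rewrite !inE => /andP[/orP[]/eqP-> /orP[]]; rewrite ?(negbTE uv) // => E.
- by rewrite (eq_sym (par v)) E orbT.
- by rewrite E.
- by rewrite E !orbT.
Qed.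

Lemma consec_cat (T : eqType) (s1 s2 : seq T) u v :
  consec (s1 ++ u :: v :: s2) u v.
Proof.
elim: s1 => [|x s1 IH]; first by rewrite /consec /= inE eqxx.
rewrite /consec in IH *; case: s1 IH => [|y s1] /= IH;
  by rewrite inE IH orbT.
Qed.

Lemma consecP (T : eqType) (s : seq T) u v :
  reflect (exists s1 s2, s = s1 ++ u :: v :: s2) (consec s u v).
Proof.
apply: (iffP idP) => [|[s1 [s2 ->]]]; last exact: consec_cat.
elim: s => // x [|y s] IH //; rewrite /consec /= inE => /orP[/eqP[-> ->]|].
  by exists [::], s.
by case/IH=> s1 [s2 ->]; exists (x :: s1), s2.
Qed.

Lemma consec_rev (T : eqType) (s : seq T) u v : consec s u v -> consec (rev s) v u.
Proof.
case/consecP=> s1 [s2 ->]; apply/consecP; exists (rev s2), (rev s1).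
by rewrite rev_cat !rev_cons -!cats1 -!catA.
Qed.

(** * The comb with a subdivided spine *)

Section StretchedComb.

Variables (N : nat) (a h : nat -> nat).
Hypothesis a_lt : forall i j, i < j -> j <= N -> a i < a j.

(** [a i] is the stretched position of the [i]-th spine vertex. Under [a_lt] the maximum has at most
    one term; between junctions it is empty, hence 0. *)
Definition tooth_height (x : nat) : nat := \max_(i < N.+1 | a i == x) h i.

Definition comb_seq : seq (nat * nat) :=
  [seq (x, j) | x <- iota (a 0) (a N - a 0).+1, j <- iota 0 (tooth_height x).+1].

Lemma a_le i j : i <= j -> j <= N -> a i <= a j.
Proof. by rewrite leq_eqVlt => /orP[/eqP->|ij] // jN; rewrite ltnW // a_lt. Qed.

Lemma a_inj i j : i <= N -> j <= N -> a i = a j -> i = j.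
Proof.
move=> iN jN E; case: (ltngtP i j) => // ij.
  by have := a_lt ij jN; lia.
by have := a_lt ij iN; lia.
Qed.

Lemma mem_comb_seq x j :
  ((x, j) \in comb_seq) = (a 0 <= x <= a N) && (j <= tooth_height x).
Proof.
have aN := a_le (leq0n N) (leqnn N).
apply/allpairsPdep/idP => [[x' [j' []]]|].
  by rewrite !mem_iota => ? ? [-> ->]; lia.
by move=> H; exists x, j; rewrite !mem_iota; split=> //; lia.
Qed.

Lemma tooth_heightE i : i <= N -> tooth_height (a i) = h i.
Proof.
move=> iN; rewrite /tooth_height (big_pred1 (Ordinal (iN : i < N.+1))) // => k /=.
apply/eqP/eqP => [E|-> //]; apply: val_inj => /=; apply: a_inj E => //.
by rewrite -ltnS.
Qed.

Lemma tooth_height_gt0 x : 0 < tooth_height x -> exists2 i, i <= N & x = a i.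
Proof.
move=> H; have [/existsP[i /eqP E]|/existsPn no] := boolP [exists i : 'I_N.+1, a i == x].
  by exists i => //; rewrite -ltnS.
by move: H; rewrite /tooth_height big_pred0 // => i; apply/negbTE.
Qed.

Lemma comb_seq0 x : a 0 <= x <= a N -> (x, 0) \in comb_seq.
Proof. by rewrite mem_comb_seq leq0n andbT. Qed.

Lemma comb_seq_tooth i j : i <= N -> j <= h i -> (a i, j) \in comb_seq.
Proof.
move=> iN jh; rewrite mem_comb_seq tooth_heightE // jh andbT.
by rewrite !a_le.
Qed.

Lemma spine_pos n x : n <= N -> a 0 <= x <= a n ->
  exists2 i, i <= n & x = a i \/ (i < n /\ a i < x < a i.+1).
Proof.
elim: n => [|n IH] nN H; first by exists 0 => //; left; lia.
have [xn|nx] := leqP x (a n).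
  have [||i iN' E] := IH; [lia|lia|].
  by exists i; [lia|case: E => [|[? ?]]; [left|right; split=> //; lia]].
have [E|E] := eqVneq x (a n.+1); first by exists n.+1; [|left].
by exists n => //; right; split=> //; lia.
Qed.

Definition scomb_vertex : finType := seq_sub comb_seq.

Definition scomb_adj (u v : scomb_vertex) : bool := comb_adj (val u) (val v).

Lemma scomb_sym : symmetric scomb_adj.
Proof. by move=> u v; apply: comb_adj_sym. Qed.

Lemma scomb_irr : irreflexive scomb_adj.
Proof. by move=> u; apply: comb_adj_irr. Qed.

Definition scomb : sgraph := SGraph scomb_sym scomb_irr.

Lemma scomb_root_proof : (a 0, 0) \in comb_seq.
Proof. by apply: comb_seq0; rewrite leqnn a_le. Qed.

Definition scomb_root : scomb := SeqSub scomb_root_proof.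

Definition scomb_mk (p : nat * nat) : scomb := insubd scomb_root p.

Lemma scomb_mkK p : p \in comb_seq -> val (scomb_mk p) = p.
Proof. by move=> ps; rewrite val_insubd ps. Qed.

(** Only spine edges are subdivided: the edge from [i] to [i.+1] receives the positions strictly
    between [a i] and [a i.+1]. Tooth edges are kept. *)
Lemma scomb_subdivision (T : sgraph) (co : T -> nat * nat) :
  injective co ->
  (forall x, (co x).1 <= N /\ (co x).2 <= h (co x).1) ->
  (forall i j, i <= N -> j <= h i -> exists x, co x = (i, j)) ->
  (forall x y, adj x y = comb_adj (co x) (co y)) ->
  subdivision T scomb.
Proof.
move=> ci cd cs ca.
pose m x := scomb_mk (x, 0).
pose f x := scomb_mk (a (co x).1, (co x).2).
have fE x : val (f x) = (a (co x).1, (co x).2).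
  by case: (cd x) => ? ?; apply: scomb_mkK; apply: comb_seq_tooth.
pose J i := map m (iota (a i).+1 (a i.+1 - (a i).+1)).
(* A spine edge read from right to left gets the reversed interior; every pair that is not a spine
   edge gets the empty one. *)
pose I x y := if ((co x).2 == 0) && ((co y).2 == 0) then
  if (co y).1 == (co x).1.+1 then J (co x).1 else
  if (co x).1 == (co y).1.+1 then rev (J (co y).1) else [::] else [::].
have mE x : a 0 <= x <= a N -> val (m x) = (x, 0).
  by move=> H; apply: scomb_mkK; apply: comb_seq0.
have Irev x y : I y x = rev (I x y).
  rewrite /I andbC; case: ifP => // _; case: (eqVneq (co x).1 (co y).1.+1) => E.
    by rewrite ifF; [rewrite revK|apply/eqP; lia].
  by case: ifP.
(* The position of an interior vertex determines its spine edge, which yields both disjointness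
   clauses of a subdivision. *)
have IP u x y : adj x y -> u \in I x y -> exists i z,
    [/\ i < N, a i < z < a i.+1, u = m z &
      (co x = (i, 0) /\ co y = (i.+1, 0)) \/ (co x = (i.+1, 0) /\ co y = (i, 0))].
  move=> axy; rewrite /I; case: ifP => // /andP[/eqP x0 /eqP y0].
  have key x' y' : (co x').2 = 0 -> (co y').2 = 0 -> (co y').1 = (co x').1.+1 ->
      u \in J (co x').1 -> exists i z, [/\ i < N, a i < z < a i.+1, u = m z &
        co x' = (i, 0) /\ co y' = (i.+1, 0)].
    move=> x'0 y'0 E /mapP[z]; rewrite mem_iota => zI ->; exists (co x').1, z.
    have [yN _] := cd y'; rewrite E in yN; split=> //.
      have := a_lt (ltnSn (co x').1) yN; lia.
    by move: x'0 y'0 E; case: (co x') (co y') => [? ?] [? ?] /= -> -> ->.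
  case: eqP => [E H|_].
    by have [i [z [? ? ? ?]]] := key x y x0 y0 E H; exists i, z; split=> //; left.
  case: eqP => [E H|//]; rewrite mem_rev in H.
  have [i [z [? ? ? [? ?]]]] := key y x y0 x0 E H.
  by exists i, z; split=> //; right.
(* Read from left to right, the path replacing a spine edge is an interval of consecutive spine
   positions. *)
have PE x y i : i < N -> co x = (i, 0) -> co y = (i.+1, 0) ->
    f x :: rcons (I x y) (f y) = map m (iota (a i) (a i.+1 - a i).+1).
  move=> iN xE yE; have aa := a_lt (ltnSn i) iN.
  rewrite /I xE yE /= eqxx /f xE yE /= -/(m _) -/(m _) -map_rcons; congr (_ :: map m _).
  rewrite -[RHS](cat_take_drop (a i.+1 - (a i).+1)) take_iota drop_iota.
  rewrite (_ : minn _ _ = a i.+1 - (a i).+1); last by lia.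
  rewrite (_ : _ - (a i.+1 - _) = 1); last by lia.
  by rewrite cats1 /=; congr (rcons _ _); lia.
exists f, I; split.
- move=> x y E; apply: ci; have := congr1 val E; rewrite !fE.
  case: (cd x) (cd y) => [xN _] [yN _].
  case: (co x) (co y) xN yN => [i j] [i' j'] /= iN i'N [/a_inj-> //].
  by move->.
- move=> x y axy; split=> //.
  have up x' y' i : i < N -> co x' = (i, 0) -> co y' = (i.+1, 0) ->
      is_path (f x' :: rcons (I x' y') (f y')).
    move=> iN xE yE; rewrite (PE x' y' i) //; have aN := a_le (leq0n i) (ltnW iN).
    have Ni := a_le iN (leqnn N); have aa := a_lt (ltnSn i) iN.
    have inr z : z \in iota (a i) (a i.+1 - a i).+1 -> a 0 <= z <= a N.
      by rewrite mem_iota; lia.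
    split=> //.
      rewrite map_inj_in_uniq ?iota_uniq // => u v /inr uI /inr vI /(congr1 val).
      by rewrite !mE // => -[].
    rewrite sorted_map.
    have : all (fun z => a 0 <= z <= a N) (iota (a i) (a i.+1 - a i).+1).
      by apply/allP => z /inr.
    move: (a i.+1 - a i).+1 => n; elim: n (a i) => //= -[|n] IH b //= /andP[bI /andP[b1I H]].
    rewrite /scomb_adj !mE // {1}/comb_adj /= eqxx orbT /=.
    by apply: IH; rewrite /= b1I.
  have revP x' y' : is_path (f x' :: rcons (I x' y') (f y')) ->
      is_path (f y' :: rcons (I y' x') (f x')).
    have -> : f y' :: rcons (I y' x') (f x') = rev (f x' :: rcons (I x' y') (f y')).
      by rewrite rev_cons rev_rcons Irev.
    case=> _ uP sP; split; first by rewrite -size_eq0 size_rev.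
      by rewrite rev_uniq.
    by rewrite rev_sorted (eq_sorted (e' := @adj scomb)) // => ? ?; apply: adj_sym.
  have := axy; rewrite ca => cxy.
  have [xN _] := cd x; have [yN _] := cd y.
  have [xy1|nxy] := eqVneq (co x).1 (co y).1.
    have fxy : scomb_adj (f x) (f y).
      by move: cxy; rewrite /scomb_adj !fE /comb_adj xy1 /= eqxx; lia.
    have -> : I x y = [::].
      by rewrite /I; case: ifP => //; rewrite !ifF //; lia.
    split=> //=; last by rewrite fxy.
    by rewrite inE andbT; apply: contraTneq fxy => ->; rewrite scomb_irr.
  have [x2 y2] : (co x).2 = 0 /\ (co y).2 = 0.
    by move: cxy; rewrite /comb_adj (negbTE nxy); lia.
  have [E|E] : (co y).1 = (co x).1.+1 \/ (co x).1 = (co y).1.+1.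
    by move: cxy; rewrite /comb_adj (negbTE nxy); lia.
    apply: (up x y (co x).1); rewrite -?E //.
      by rewrite -x2; case: (co x).
    by rewrite -y2; case: (co y).
  apply: revP; apply: (up y x (co y).1); rewrite -?E //.
    by rewrite -y2; case: (co y).
  by rewrite -x2; case: (co x).
- move=> x y z axy; apply/negP => /(IP _ _ _ axy) [i [z' [iN z'I]]].
  move/(congr1 val); rewrite fE mE => [[E _] _|]; last first.
    by have := a_le (leq0n i) (ltnW iN); have := a_le iN (leqnn N); lia.
  have [zN _] := cd z; have [ki|ik] := leqP (co z).1 i.
    by have := a_le ki (ltnW iN); lia.
  by have := a_le ik zN; lia.
- move=> x y x' y' u axy axy' /(IP _ _ _ axy) [i [z [iN zI -> E]]].
  move=> /(IP _ _ _ axy') [i' [z' [iN' zI' /(congr1 val) Ez E']]].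
  have ii k w : k < N -> a k < w < a k.+1 -> a 0 <= w <= a N.
    move=> kN; have := a_le (leq0n k) (ltnW kN); have := a_le kN (leqnn N); lia.
  rewrite !mE in Ez; try by [apply: ii zI | apply: ii zI'].
  case: Ez => Ez; rewrite -{z'}Ez in zI'.
  have Ei : i = i'.
    case: (ltngtP i i') => // lti.
      by have := a_le lti (ltnW iN'); lia.
    by have := a_le lti (ltnW iN); lia.
  rewrite -{i'}Ei in iN' zI' E'.
  have cc p q r : co p = r -> co q = r -> p = q by move=> Ep Eq; apply: ci; rewrite Ep.
  case: E E' => [[E1 E2]|[E1 E2]] [[E3 E4]|[E3 E4]].
  + by rewrite (cc _ _ _ E1 E3) (cc _ _ _ E2 E4).
  + by rewrite (cc _ _ _ E1 E4) (cc _ _ _ E2 E3) setUC.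
  + by rewrite (cc _ _ _ E1 E4) (cc _ _ _ E2 E3) setUC.
  + by rewrite (cc _ _ _ E1 E3) (cc _ _ _ E2 E4).
have sp i : i < N -> exists x y, [/\ adj x y, co x = (i, 0) & co y = (i.+1, 0)].
  move=> iN; have [x' x'E] := cs i 0 (ltnW iN) isT.
  have [y' y'E] := cs i.+1 0 iN isT.
  by exists x', y'; split=> //; rewrite ca x'E y'E /comb_adj /=; lia.
split.
- move=> u; case E: (val u) (valP u) => [x j]; rewrite mem_comb_seq => /andP[xI jh].
  have [j0|jp] := posnP j.
    have [i iN [Ei|[iN' Ix]]] := spine_pos (leqnn N) xI.
      left; have [z zE] := cs i 0 iN isT; exists z; apply: val_inj.
      by rewrite fE E zE /= j0 Ei.
    right; have [z [y [azy zE yE]]] := sp i iN'; exists z, y; split=> //.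
    rewrite /I zE yE /= eqxx; apply/mapP; exists x.
      by rewrite mem_iota; lia.
    by apply: val_inj; rewrite mE // E j0.
  left; have [i iN Ei] := tooth_height_gt0 (leq_trans jp jh).
  have [|z zE] := cs i j iN; first by rewrite -tooth_heightE // -Ei.
  by exists z; apply: val_inj; rewrite fE E zE /= Ei.
- move=> u v.
  (* By symmetry it suffices that [u'] is just above [v'] in a tooth or just to its right on the
     spine. *)
  have main u' v' : val u' = ((val v').1, (val v').2.+1) \/
      (val v').2 = 0 /\ val u' = ((val v').1.+1, 0) ->
      exists x y, [/\ adj x y, consec (f x :: rcons (I x y) (f y)) v' u'
        & consec (f y :: rcons (I y x) (f x)) u' v'].
    case E : (val v') (valP v') => [x j] /=; rewrite mem_comb_seq => /andP[xI jh].
    case=> [Eu|[j0 Eu]]; have := ssvalP u'; rewrite Eu mem_comb_seq => /andP[xI' jh'].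
      have [i iN Ei] := tooth_height_gt0 (leq_trans (ltn0Sn j) jh').
      rewrite Ei tooth_heightE // in jh'.
      have [z zE] := cs i j iN (ltnW jh').
      have [z' z'E] := cs i j.+1 iN jh'.
      have fz : f z = v' by apply: val_inj; rewrite fE E zE Ei.
      have fz' : f z' = u' by apply: val_inj; rewrite fE z'E /= -Ei; apply: esym Eu.
      exists z, z'; rewrite ca zE z'E -fz -fz' /I zE z'E /= andbF.
      by rewrite /comb_adj /consec /= !inE !eqxx !orbT.
    have [i iN Ei] := spine_pos (leqnn N) xI.
    have iN' : i < N.
      by case: Ei => [Ei|[]//]; rewrite ltn_neqAle iN andbT; apply: contraTneq xI' => <-; lia.
    have {}Ei : a i <= x < a i.+1.
      by case: Ei => [Ei|[]]; last lia; have := a_lt (ltnSn i) iN'; lia.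
    have [z [z' [az zE z'E]]] := sp i iN'.
    have C : consec (f z :: rcons (I z z') (f z')) v' u'.
      rewrite (PE _ _ i) // (_ : (a i.+1 - a i).+1 = (x - a i) + (2 + (a i.+1 - x.+1))); last by lia.
      rewrite iotaD map_cat (_ : a i + (x - a i) = x); last by lia.
      have -> : v' = m x by apply: val_inj; rewrite mE // E j0.
      have -> : u' = m x.+1 by apply: val_inj; rewrite mE //; apply: Eu.
      exact: consec_cat.
    exists z, z'; split=> //; have := consec_rev C.
    by rewrite rev_cons rev_rcons (Irev z z').
  rewrite /= /scomb_adj; case Eu: (val u) => [x j]; case Ev: (val v) => [y k].
  rewrite {1}/comb_adj /= => auv.
  have /orP[H|H] : (x == y) && (j == k.+1) || [&& j == 0, k == 0 & x == y.+1] ||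
    ((y == x) && (k == j.+1) || [&& k == 0, j == 0 & y == x.+1]) by lia.
    have [|p [q [apq _ C]]] := main u v; last by exists q, p; rewrite adj_sym.
    rewrite Eu Ev /=; case/orP: H => [/andP[/eqP-> /eqP->]|/and3P[/eqP-> /eqP-> /eqP->]].
      by left.
    by right.
  have [|p [q [apq C _]]] := main v u; last by exists p, q.
  rewrite Eu Ev /=; case/orP: H => [/andP[/eqP-> /eqP->]|/and3P[/eqP-> /eqP-> /eqP->]].
    by left.
  by right.
Qed.

End StretchedComb.

(** * Connected sets and levels *)

Section Within.

Variable G : sgraph.
Implicit Types (A B U : {set G}) (x y z w : G).

Definition within A : rel G := fun x y => [&& adj x y, x \in A & y \in A].

Definition conn A : bool :=
  [forall x in A, forall y in A, connect (within A) x y].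

Lemma connP A : reflect {in A &, forall x y, connect (within A) x y} (conn A).
Proof.
apply: (iffP forall_inP) => [H x y xA yA|H x xA].
  exact: (forall_inP (H x xA)).
by apply/forall_inP => y yA; apply: H.
Qed.

Lemma within_sym A : connect_sym (within A).
Proof.
by apply: sym_connect_sym => x y; rewrite /within adj_sym; congr andb; apply: andbC.
Qed.

Lemma withinS A B x y :
  A \subset B -> connect (within A) x y -> connect (within B) x y.
Proof.
move=> /subsetP AB; apply: connect_sub => u v /and3P[uv uA vA].
by apply: connect1; rewrite /within uv !AB.
Qed.

(** A walk in [A] that starts in [B] can never leave [B], so it also witnesses connectivity within
    [B]. *)
Lemma within_trap A B x y :
  (forall u v, u \in B -> v \in A -> adj u v -> v \in B) ->
  x \in B -> connect (within A) x y -> y \in B /\ connect (within B) x y.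
Proof.
move=> H xB /connectP[p]; elim: p x xB => [|z p IH] x xB /=.
  by move=> _ ->.
case/andP=> /and3P[xz xA zA] pp pE; have zB := H _ _ xB zA xz.
have [yB zy] := IH z zB pp pE; split=> //.
by apply: connect_trans zy; apply: connect1; rewrite /within xz xB.
Qed.

Lemma conn_star A x :
  {in A, forall y, connect (within A) y x} -> conn A.
Proof.
move=> H; apply/connP => y z yA zA.
by apply: connect_trans (H y yA) _; rewrite within_sym H.
Qed.

(** [d] is the distance from [r] within [U], obtained as the length of a shortest walk. These three
    facts carry all later breadth-first arguments. *)
Lemma conn_levels U r : conn U -> r \in U ->
  exists d : G -> nat,
  [/\ d r = 0,
      {in U, forall y, y != r -> exists2 z, z \in U & adj z y /\ d y = (d z).+1}
    & {in U &, forall y z, adj y z -> d z <= (d y).+1}].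
Proof.
move=> cU rU; pose e := within U.
pose walk y n := [exists p : n.-tuple G, path e r p && (last r p == y)].
have walkP y p : path e r p -> last r p = y -> walk y (size p).
  by move=> pp pE; apply/existsP; exists (in_tuple p); rewrite /= pp pE eqxx.
(* Vertices outside [U] get the dummy value 0, which makes [d] total. *)
have min_walk y : exists n, y \in U -> walk y n /\ forall m, walk y m -> n <= m.
  have [yU|] := boolP (y \in U); last by exists 0.
  have /connectP[p pp pE] := connP _ cU _ _ rU yU.
  have ex : exists n, walk y n by exists (size p); apply: walkP.
  by exists (ex_minn ex) => _; case: ex_minnP.
have [d dP] := fin_all_exists min_walk.
exists d; split.
- by have [_ /(_ 0)] := dP r rU; rewrite leqn0 => H; apply/eqP/H/(walkP r [::]).
- move=> y yU yr; have [/existsP[p /andP[pp /eqP pE]] ymin] := dP y yU.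
  case/lastP: {p}(val p) (size_tuple p) pp pE => [|p z] szp.
    by move=> _ /= E; rewrite E eqxx in yr.
  rewrite rcons_path last_rcons => /andP[pp /and3P[ly lU _]] zy.
  rewrite zy in ly; exists (last r p) => //; split=> //.
  have [/existsP[q /andP[qq /eqP qE]] lmin] := dP _ lU.
  apply/eqP; rewrite eqn_leq; apply/andP; split.
    rewrite -(size_tuple q) -(size_rcons q y); apply: ymin.
    apply: walkP; last by rewrite last_rcons.
    by rewrite rcons_path qq qE /e /within ly lU.
  by rewrite -szp size_rcons ltnS; apply: lmin; apply: walkP.
- move=> y z yU zU yz; have [/existsP[q /andP[qq /eqP qE]] ymin] := dP y yU.
  have [_ zmin] := dP z zU.
  rewrite -(size_tuple q) -(size_rcons q z); apply: zmin.
  apply: walkP; last by rewrite last_rcons.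
  by rewrite rcons_path qq qE /e /within yz yU.
Qed.

(** An edge changes the level by at most one, so a path with exactly one vertex at each level has no
    chords. *)
Lemma level_path_adj U (d : G -> nat) (q : nat -> G) n :
  {in U &, forall y z, adj y z -> d z <= (d y).+1} ->
  (forall x : nat, x <= n -> q x \in U /\ d (q x) = x) ->
  (forall x : nat, x < n -> adj (q x) (q x.+1)) ->
  forall x y : nat, x <= n -> y <= n ->
    adj (q x) (q y) = (x == y.+1) || (y == x.+1).
Proof.
move=> lip qU qa x y xn yn; have [[qx dx] [qy dy]] := (qU _ xn, qU _ yn).
apply/idP/orP => [a|[]/eqP E]; last first.
- by rewrite E; apply: qa; rewrite -E.
- by rewrite adj_sym E; apply: qa; rewrite -E.
have := lip _ _ qx qy a; rewrite adj_sym in a; have := lip _ _ qy qx a.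
rewrite dx dy => H1 H2.
have : x != y by apply: contraTneq a => ->; rewrite adj_irr.
by move=> ?; lia.
Qed.

Lemma leq_card_bigcup (I : finType) (A : {set I}) (F : I -> {set G}) m :
  {in A, forall i, #|F i| <= m} -> #|\bigcup_(i in A) F i| <= #|A| * m.
Proof.
move=> Fm; rewrite -sum_nat_const.
apply: (@leq_trans (\sum_(i in A) #|F i|)); last exact: leq_sum.
elim/big_rec2: _ => [|i m' B _ IH]; first by rewrite cards0.
by apply: leq_trans (leq_card_setU _ _) _; rewrite leq_add2l.
Qed.

(** A ball of radius [M] has at most [D.+1 ^ M] vertices, so some vertex of [U] is farther than [M]
    from [w]. A shortest path to it is induced, and its first [M] steps are taken. *)
Lemma conn_geodesic U w D M : max_degree_le G D -> conn U -> w \in U ->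
  D.+1 ^ M < #|U| ->
  exists l : nat -> G, [/\ l 0 = w, forall j, j <= M -> l j \in U
    & forall j k, j <= M -> k <= M -> (l j = l k -> j = k) /\
        adj (l j) (l k) = (j == k.+1) || (k == j.+1)].
Proof.
move=> degG cU wU bigU; have [d [dw dpar dlip]] := conn_levels cU wU.
pose ball n := [set y in U | d y <= n].
have ball_card n : #|ball n| <= D.+1 ^ n.
  elim: n => [|n IH].
    rewrite expn0 -(cards1 w); apply/subset_leq_card/subsetP => y.
    rewrite !inE leqn0 => /andP[yU /eqP dy]; apply: contraT => yw.
    by have [z _ [_]] := dpar _ yU yw; rewrite dy.
  rewrite expnSr; apply: leq_trans (leq_mul IH (leqnn _)).
  (* The next ball is covered by the vertices of the previous one and their neighbours, hence the
     factor [D.+1]. *)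
  apply: (@leq_trans #|\bigcup_(z in ball n) (z |: [set y | adj z y])|).
    apply/subset_leq_card/subsetP => y; rewrite inE => /andP[yU dy].
    have [->|yw] := eqVneq y w.
      by apply/bigcupP; exists w; rewrite !inE ?eqxx // wU dw.
    have [z zU [zy E]] := dpar _ yU yw.
    apply/bigcupP; exists z; rewrite !inE ?zy ?orbT // zU; lia.
  apply: leq_card_bigcup => z _; apply: leq_trans (leq_card_setU _ _) _.
  by rewrite cards1 add1n ltnS; apply: degG.
have [y yU dy] : exists2 y, y \in U & M < d y.
  apply/exists_inP; rewrite -[X in is_true X]negbK negb_exists_in.
  apply/forall_inP => H; have := ball_card M; rewrite leqNgt => /negP; apply.
  apply: leq_trans bigU _; apply/subset_leq_card/subsetP => y yU.
  by rewrite inE yU leqNgt H.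
(* Tracing predecessors back from [y] gives one vertex at each level. *)
have [l [l0 _ lU la]] : exists l : nat -> G, [/\ l 0 = w, l (d y) = y,
    forall j, j <= d y -> l j \in U /\ d (l j) = j
    & forall j, j < d y -> adj (l j) (l j.+1)].
  have [n Hn] : exists n, d y = n by exists (d y).
  rewrite Hn; elim: n y yU {dy} Hn => [|n IH] y yU dy.
    exists (fun=> w); split=> //; last first.
      by move=> j; rewrite leqn0 => /eqP->; rewrite wU dw.
    by have [->//|yw] := eqVneq y w; have [z _ [_]] := dpar _ yU yw; rewrite dy.
  have yw : y != w by apply: contraTneq isT => yw; rewrite yw dw in dy.
  have [z zU [zy E]] := dpar _ yU yw; have dz : d z = n by lia.
  have [l [l0 ln lU la]] := IH z zU dz.
  exists (fun j => if j == n.+1 then y else l j); split=> //.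
  - by rewrite eqxx.
  - by move=> j jn; case: eqP => [->//|jn1]; apply: lU; lia.
  - move=> j; rewrite ltnS eqSS leq_eqVlt => /predU1P[->|jn].
      by rewrite eqxx ltn_eqF // ln.
    by rewrite !ltn_eqF // ?la // ltnW.
exists l; split=> // [j jM|j k jM kM].
  by have [] := lU j (leq_trans jM (ltnW dy)).
have jd := leq_trans jM (ltnW dy); have kd := leq_trans kM (ltnW dy).
split; last exact: level_path_adj dlip lU la _ _ jd kd.
by move=> E; have [_ <-] := lU _ jd; rewrite E; have [_ ->] := lU _ kd.
Qed.

End Within.

(** * Geodesics with many branchings *)

Section Branching.

Variables (T : finType) (R : rel T) (X : {set T}) (d : T -> nat) (D : nat).
Hypothesis R_level : forall u c, R u c -> d c = (d u).+1.
Hypothesis R_deg : forall u, #|[set c | R u c]| <= D.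
Hypothesis D_gt0 : 0 < D.

Definition descendants (u : T) : {set T} := [set x in X | connect R u x].

Definition branch_event (p : nat -> T) (x : nat) : bool :=
  (p x \in X) || [exists w, R (p x) w && (w != p x.+1)].

Lemma connect_child u x : connect R u x -> x != u ->
  exists2 c, R u c & connect R c x.
Proof.
case/connectP=> -[_ ->|c p /= /andP[uc pp] pE _]; first by rewrite eqxx.
by exists c => //; apply/connectP; exists p.
Qed.

(** Children may share descendants, hence only an inequality. *)
Lemma card_descendants u :
  #|descendants u| <= (u \in X) + \sum_(c in [set c | R u c]) #|descendants c|.
Proof.
apply: (@leq_trans #|(X :&: [set u]) :|: \bigcup_(c in [set c | R u c]) descendants c|).
  apply/subset_leq_card/subsetP => x; rewrite !inE => /andP[xX ux].
  have [xu|xu] := eqVneq x u; first by rewrite xX.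
  have [c uc cx] := connect_child ux xu.
  by apply/orP; right; apply/bigcupP; exists c; rewrite !inE ?xX.
apply: leq_trans (leq_card_setU _ _) (leq_add _ _).
  have [uX|uX] := boolP (u \in X).
    by rewrite /= -(cards1 u) subset_leq_card ?subsetIr.
  rewrite leqn0 cards_eq0 -subset0; apply/subsetP => x; rewrite !inE.
  by case/andP=> xX /eqP E; rewrite -E xX in uX.
elim/big_rec2: _ => [|i m B _ IH]; first by rewrite cards0.
by apply: leq_trans (leq_card_setU _ _) _; rewrite leq_add2l.
Qed.

(** The path always moves to the child with the most descendants. Nothing is lost where there is no
    event, and at an event [D.+1 ^ M.+1] descendants leave at least [D.+1 ^ M] below that child. *)
Lemma branching_path M u : D.+1 ^ M <= #|descendants u| ->
  exists n (p : nat -> T), [/\ p 0 = u, forall x, x < n -> R (p x) (p x.+1)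
    & M <= count (branch_event p) (iota 0 n)].
Proof.
(* Levels increase along [R] and are bounded, so the number of levels left is the induction
   measure. *)
have [m] := ubnP (\max_y d y - d u).
elim: m M u => // m IH M u mu bigS.
case: M bigS => [|M] bigS; first by exists 0, (fun=> u).
have Spos : 0 < #|descendants u| by apply: leq_trans bigS; rewrite expn_gt0.
have step c M' : R u c -> D.+1 ^ M' <= #|descendants c| ->
    (forall p, p 0 = u -> p 1 = c -> M < branch_event p 0 + M') ->
    exists n (p : nat -> T), [/\ p 0 = u, forall x, x < n -> R (p x) (p x.+1)
      & M < count (branch_event p) (iota 0 n)].
  move=> uc bigc ev; have [|n [p [p0 pR pc]]] := IH M' c _ bigc.
    have := R_level uc; have := leq_bigmax (F := d) c; lia.
  exists n.+1, (fun x => if x is x'.+1 then p x' else u); split=> //.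
    by case=> [|x]; [rewrite p0|apply: pR].
  rewrite /= -[1]/(1 + 0) iotaDl count_map.
  apply: leq_trans (leq_add (leqnn _) pc); apply: ev => //.
pose C := [set c | R u c].
(* Without children there is at most one descendant, fewer than [D.+1 ^ M.+1]. *)
have [C0|[c0 c0C]] := set_0Vmem C.
  have := card_descendants u; rewrite -/C C0 big_set0 addn0 => le1.
  have : D.+1 ^ M.+1 <= 1 by apply: leq_trans bigS (leq_trans le1 (leq_b1 _)).
  by rewrite leqNgt -{1}(exp1n M.+1) ltn_exp2r // ltnS D_gt0.
have [c cC cmax] : exists2 c, c \in C &
    {in C, forall c', #|descendants c'| <= #|descendants c|}.
  by case: (arg_maxnP (fun c => #|descendants c|) c0C) => c cC cmax; exists c.
have uc : R u c by rewrite inE in cC.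
have [ev|] := boolP ((u \in X) || [exists w, R u w && (w != c)]).
  apply: (step c M uc); last first.
    by move=> p p0 p1; rewrite /branch_event p0 p1 ev.
  (* One descendant may be [u] itself; the others are spread over at most [D] children, none with
     more than [c]. *)
  have : #|descendants u| <= 1 + D * #|descendants c|.
    apply: leq_trans (card_descendants u) (leq_add (leq_b1 _) _).
    apply: (@leq_trans (\sum_(c' in C) #|descendants c|)); first exact: leq_sum.
    by rewrite sum_nat_const leq_mul2r R_deg orbT.
  move/(leq_trans bigS); rewrite expnS; have : 0 < D.+1 ^ M by rewrite expn_gt0.
  by move: (_ ^ _) #|_| => b a; nia.
rewrite negb_or => /andP[uX /existsPn only].
(* Here [u] lies outside [X] and [c] is its only child, so all descendants survive. *)
apply: (step c M.+1 uc); last by move=> p _ _; rewrite leq_addl.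
apply: leq_trans bigS (leq_trans (card_descendants u) _).
rewrite (negbTE uX) (_ : [set _ | _] = [set c]) ?big_set1 //.
apply/setP => w; rewrite !inE; apply/idP/eqP => [uw|-> //].
by have := only w; rewrite uw /= negbK => /eqP.
Qed.

End Branching.

(** * Private parts *)

Section Private.

Variables (G : sgraph) (Z P : {set G}).
Hypotheses (cZ : conn Z) (PZ : P \subset Z).
Implicit Types (x y z w : G).

(** The union of the components of [Z :\ w] that miss [P]: the part of [Z] that only [w] joins to
    the path. *)
Definition private w : {set G} :=
  [set y in Z :\ w | ~~ [exists p in P :\ w, connect (within (Z :\ w)) y p]].

Lemma privateP w y : reflect
  [/\ y \in Z, y != w & forall p, p \in P -> p != w ->
       ~~ connect (within (Z :\ w)) y p] (y \in private w).
Proof.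
apply: (iffP idP); rewrite !inE.
  case/andP=> /andP[yw yZ] /exists_inPn H; split=> // p pP pw.
  by apply: H; rewrite !inE pw.
case=> -> -> H /=; apply/exists_inPn => p; rewrite !inE => /andP[pw pP].
exact: H.
Qed.

Lemma private_closed w y z :
  y \in private w -> z \in Z -> z != w -> adj y z -> z \in private w.
Proof.
case/privateP=> yZ yw yP zZ zw yz; apply/privateP; split=> // p pP pw.
apply: contra (yP p pP pw); apply: connect_trans; apply: connect1.
by rewrite /within yz !inE yZ zZ yw zw.
Qed.

Lemma private_path w p : p \in P -> p \notin private w.
Proof.
move=> pP; apply/privateP => -[pZ pw H].
by have := H p pP pw; rewrite connect0.
Qed.

Lemma private_self w : w \notin private w.
Proof. by apply/privateP => -[_]; rewrite eqxx. Qed.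

Lemma private_near w w' p : w' \in Z -> w' != w -> p \in P -> p != w ->
  w' = p \/ adj w' p -> w' \notin private w.
Proof.
move=> wZ ww pP pw H; apply/privateP => -[_ _ /(_ p pP pw)/negP]; apply.
case: H => [->|a]; first exact: connect0.
by apply: connect1; rewrite /within a !inE wZ ww pw (subsetP PZ).
Qed.

(** A walk from [y] to [w] in [Z] stays in the private part until it first meets [w]. *)
Lemma private_connect w y : w \in Z -> y \in private w ->
  connect (within (w |: private w)) y w.
Proof.
move=> wZ yD; have [yZ _ _] := privateP _ _ yD.
have /connectP[p] := connP _ cZ _ _ yZ wZ.
elim: p y yD {yZ} => [|z p IH] y yD /=.
  by move=> _ E; move: yD; rewrite -E (negbTE (private_self w)).
case/andP=> /and3P[yz yZ zZ] pp pE.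
have [zw|zw] := eqVneq z w.
  by rewrite zw in yz; apply: connect1; rewrite /within yz !in_setU1 yD eqxx orbT.
have zD := private_closed yD zZ zw yz.
by apply: connect_trans (IH z zD pp pE); apply: connect1; rewrite /within yz !in_setU1 yD zD !orbT.
Qed.

Lemma private_conn w : w \in Z -> conn (w |: private w).
Proof.
move=> wZ; apply: (@conn_star _ _ w) => y /setU1P[->|yD]; first exact: connect0.
exact: private_connect.
Qed.

Lemma private_sub w : w \in Z -> w |: private w \subset Z.
Proof.
by move=> wZ; apply/subsetP => y /setU1P[->|/privateP[]].
Qed.

(** If [y] were private to both, the connected set [w |: private w], which avoids [w'], would link
    [w] to [y] and make [w] private to [w']. *)
Lemma private_disjoint w w' y : w \in Z -> w' \in Z -> w != w' ->
  w \notin private w' -> w' \notin private w ->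
  y \in private w -> y \notin private w'.
Proof.
move=> wZ wZ' ww wD wD' yD; apply/negP => yD'.
case/privateP: (yD') => yZ yw' yP.
suff : w \in private w' by rewrite (negbTE wD).
have sub : w |: private w \subset Z :\ w'.
  apply/subsetP => z; rewrite in_setU1 => /predU1P[->|zD].
    by rewrite !inE ww.
  rewrite !inE; have [zZ _ _] := privateP _ _ zD; rewrite zZ andbT.
  by apply: contraNneq wD' => <-.
have yw := withinS sub (private_connect wZ yD).
apply/privateP; split=> // p pP pw.
by apply: contra (yP p pP pw); apply: connect_trans.
Qed.

(** Inside [Z], an edge leaving [private w] must end at [w], so an edge from it to the other set
    would contradict disjointness. *)
Lemma private_anticomplete w w' y z : w \in Z -> w' \in Z -> w != w' ->
  w \notin private w' -> w' \notin private w -> ~~ adj w w' ->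
  y \in w |: private w -> z \in w' |: private w' -> y != z /\ ~~ adj y z.
Proof.
move=> wZ wZ' ww wD wD' naw.
have key u u' a b : u \in Z -> u' \in Z -> u != u' -> u \notin private u' ->
    u' \notin private u -> a \in private u -> b \in u' |: private u' ->
    a != b /\ ~~ adj a b.
  move=> uZ uZ' uu uD uD' aD bU.
  have bZ : b \in Z by apply: (subsetP (private_sub uZ')).
  have bD : b \notin private u.
    case/setU1P: bU => [->//|bD].
    by apply: private_disjoint bD => //; rewrite eq_sym.
  split; first by apply: contraNneq bD => <-.
  apply: contra bD; apply: private_closed aD bZ _.
  by case/setU1P: bU => [->|bD]; [rewrite eq_sym | apply: contraNneq uD => <-].
move=> /setU1P[->|yD]; last exact: key wZ wZ' ww wD wD' yD.
move=> /setU1P[-> //|zD]; rewrite eq_sym adj_sym.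
by apply: (key w' w) => //; rewrite ?setU11 // eq_sym.
Qed.

End Private.

(** * Legs hanging on a minimal connected set *)

Section Pendant.

Variables (G : sgraph) (k : nat) (J H P : {set G}) (L : 'I_k -> {set G})
  (v : 'I_k -> G).

(** A leg is kept only as a connected set with one attaching end. Its size and the degree bound
    later produce an induced path of prescribed length. *)
Record legged : Prop := Legged {
  leg_end : forall i, v i \in L i;
  leg_conn : forall i, conn (L i);
  leg_disjoint : forall i y, y \in L i -> y \notin J;
  leg_pendant : forall i y z, y \in L i -> y != v i -> z \in J -> ~~ adj y z;
  leg_anticomplete : forall i j y z, i != j -> y \in L i -> z \in L j ->
    y != z /\ ~~ adj y z }.

Hypothesis lJ : legged.

Definition leg_ends : {set G} := [set v i | i : 'I_k].
Definition with_legs : {set G} := H :|: \bigcup_i L i.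

Hypotheses (HJ : H \subset J :|: leg_ends) (XH : leg_ends \subset H) (cH : conn H).
Hypothesis Hmin : forall K : {set G}, leg_ends \subset K -> K \subset H ->
  conn K -> K = H.
Hypotheses (PH : P \subset H) (cP : conn P).

Local Notation Z := with_legs.

Lemma with_legs_conn : conn Z.
Proof.
have [i0 _|no_leg] := pickP (fun i : 'I_k => true); last first.
  by rewrite /with_legs big_pred0 ?setU0.
have vH i : v i \in H by apply: (subsetP XH); apply: imset_f.
apply: (@conn_star _ _ (v i0)) => y /setUP[yH|/bigcupP[i _ yL]].
  by apply: (withinS (subsetUl _ _)); apply: connP => //; apply: vH.
apply: (@connect_trans _ _ (v i)).
  apply: (@withinS _ (L i)); last exact: connP (leg_conn lJ i) _ _ yL (leg_end lJ i).
  by apply: subsetU; rewrite bigcup_sup ?orbT.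
by apply: (withinS (subsetUl _ _)); apply: connP => //; apply: vH.
Qed.

Lemma leg_meets i y : y \in L i -> y \in H -> y = v i.
Proof.
move=> yL /(subsetP HJ) /setUP[yJ|/imsetP[j _ E]].
  by have := leg_disjoint lJ yL; rewrite yJ.
have [->//|ij] := eqVneq i j.
by have [] := leg_anticomplete lJ ij yL (leg_end lJ j); rewrite E eqxx.
Qed.

Lemma leg_nbr i y z : y \in L i -> z \in Z -> adj y z ->
  z \in L i \/ y = v i /\ z \in H.
Proof.
move=> yL /setUP[zH|/bigcupP[j _ zL]] yz; last first.
  have [ij|ij] := eqVneq i j; first by left; rewrite ij.
  by have [_] := leg_anticomplete lJ ij yL zL; rewrite yz.
have /setUP[zJ|/imsetP[j _ E]] := subsetP HJ _ zH.
  by right; split=> //; apply: contraTeq yz => /(leg_pendant lJ yL); apply.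
have [ij|ij] := eqVneq i j; first by left; rewrite E -ij leg_end.
by have [_] := leg_anticomplete lJ ij yL (leg_end lJ j); rewrite -E yz.
Qed.

(** The rest of a leg is attached to [Z] only through its end, which settles a leg end [w].
    Otherwise the component of [H :\ w] containing [P] is a smaller connected set, so by minimality
    it misses a leg end, and [w] separates that leg from [P]. *)
Lemma private_leg w : w \in H -> (w \in leg_ends) || (w \notin P) ->
  exists i, L i \subset w |: private Z P w.
Proof.
move=> wH wP.
have LZ i y : y \in L i -> y \in Z by move=> yL; apply/setUP; right; apply/bigcupP; exists i.
have [/imsetP[i _ wE]|wX] := boolP (w \in leg_ends).
  exists i; apply/subsetP => y yL; rewrite in_setU1; have [//|yw] := eqVneq y w.
  apply/privateP; split=> //; first exact: LZ yL.
  move=> p pP pw; apply/negP => yp.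
  have [||pB _] := @within_trap _ _ (L i :\ w) y p _ _ yp.
  - move=> a b /setD1P[aw aL] /setD1P[bw bZ] ab; apply/setD1P; split=> //.
    by case: (leg_nbr aL bZ ab) => // -[E]; rewrite wE E eqxx in aw.
  - by rewrite !inE yw.
  move: pB; rewrite !inE => /andP[_ pL].
  by move: pw; rewrite wE (leg_meets pL) ?eqxx // (subsetP PH).
rewrite (negbTE wX) /= in wP.
pose K := [set y in H :\ w | [exists p in P, connect (within (H :\ w)) y p]].
have KH : K \subset H :\ w by apply/subsetP => y; rewrite !inE => /andP[].
have PK : P \subset K.
  apply/subsetP => p pP; rewrite !inE (subsetP PH) // andbT.
  rewrite (contraNneq _ wP) /=; last by move=> <-.
  by apply/existsP; exists p; rewrite pP connect0.
have Kcl a b : a \in K -> b \in H :\ w -> adj a b -> b \in K.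
  move=> aK bH ab; have aH := subsetP KH _ aK.
  move: aK; rewrite inE => /andP[_ /exists_inP[p pP ap]].
  rewrite inE bH /=; apply/exists_inP; exists p => //.
  by apply: connect_trans ap; apply: connect1; rewrite /within adj_sym ab bH aH.
have cK : conn K.
  have [p0 p0P|noP] := pickP (mem P); last first.
    apply/connP => x y; rewrite inE => /andP[_ /exists_inP[p pP]].
    by have := noP p; rewrite /= pP.
  apply: (@conn_star _ _ p0) => y yK.
  have := yK; rewrite inE => /andP[_ /exists_inP[p pP yp]].
  have [_ yp'] := within_trap Kcl yK yp.
  apply: connect_trans yp' _; apply: (withinS PK).
  exact: connP.
(* If [K] contained all leg ends, minimality would give [K = H], but [w] is not in [K]. *)
have [i viK] : exists i, v i \notin K.
  apply/existsP; rewrite -[X in is_true X]negbK negb_exists; apply/negP => /forallP vK.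
  have KE : K = H.
    apply: Hmin cK; last exact: subset_trans KH (subsetDl _ _).
    by apply/subsetP => _ /imsetP[i _ ->]; have := vK i; rewrite negbK.
  by have := subsetP KH w; rewrite KE wH => /(_ isT); rewrite !inE eqxx.
(* [B] collects what lies beyond [w]: the rest of [H] and the legs ending there. It is closed under
   adjacency in [Z :\ w] and misses [P]. *)
pose B := [set y | (y \in (H :\ w) :\: K) || [exists j, (y \in L j) && (v j \notin K)]].
exists i; apply/subsetP => y yL; rewrite in_setU1; have [//|yw] := eqVneq y w.
apply/privateP; split=> //; first exact: LZ yL.
move=> p pP pw; apply/negP => yp.
have vw j : v j != w by apply: contraNneq wX => <-; apply: imset_f.
have vH j : v j \in H by apply: (subsetP XH); apply: imset_f.
have HB b : b \in H -> b != w -> b \notin K -> b \in B.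
  by move=> bH bw bK; rewrite inE in_setD bK !inE bH bw.
have [||pB _] := @within_trap _ _ B y p _ _ yp.
- move=> a b aB /setD1P[bw bZ] ab.
  have main : a \in H -> a != w -> a \notin K -> b \in B.
    move=> aH aw aK; case/setUP: (bZ) => [bH|/bigcupP[j _ bL]].
      apply: HB => //; apply: contra aK => bK; apply: Kcl bK _ _.
        by rewrite !inE aw.
      by rewrite adj_sym.
    rewrite adj_sym in ab.
    have aZ : a \in Z by apply/setUP; left.
    case: (leg_nbr bL aZ ab) => [aL|[E _]].
      rewrite inE; apply/orP; right; apply/existsP; exists j.
      by rewrite bL -(leg_meets aL aH).
    rewrite E; apply: HB => //; apply: contra aK => bK; apply: Kcl bK _ _.
      by rewrite !inE aw.
    by rewrite -E.
  move: (aB); rewrite inE => /orP[|/existsP[j /andP[aL vK]]].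
    by rewrite !in_setD in_set1 => /and3P[aK aw aH]; apply: main.
  case: (leg_nbr aL bZ ab) => [bL|[E _]].
    by rewrite inE; apply/orP; right; apply/existsP; exists j; rewrite bL.
  by apply: main; rewrite E.
- by rewrite inE; apply/orP; right; apply/existsP; exists i; rewrite yL.
have pH := subsetP PH _ pP; have pK := subsetP PK _ pP.
move: pB; rewrite inE in_setD pK /= => /existsP[j /andP[pL]].
by rewrite -(leg_meets pL pH) pK.
Qed.

End Pendant.

(** * Assembling an induced comb *)

Lemma count_pigeonhole (C : finType) (f : nat -> C) (a : pred nat) s m :
  #|C| * m < count a s -> exists c, m < count (fun x => a x && (f x == c)) s.
Proof.
move=> big; apply/existsP; apply: contraLR big; rewrite negb_exists => /forallP H.
rewrite -leqNgt -sum_nat_const.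
apply: (@leq_trans (\sum_c count (fun x => a x && (f x == c)) s)); last first.
  by apply: leq_sum => c _; have := H c; rewrite -leqNgt.
elim: s {H} => //= x s IH; rewrite big_split /= leq_add //.
case: (a x) => //=; rewrite (bigD1 (f x)) //= eqxx; exact: leq_addr.
Qed.

(** The six classes are the residues modulo 3 paired with the values of [tri]. Distinct events of
    one class have equal residues, hence are at least 3 apart. *)
Lemma spaced_events (ev tri : pred nat) n N : 6 * N.+1 < count ev (iota 0 n) ->
  exists (e : nat -> nat) (b : bool),
    (forall i, i <= N -> [/\ ev (e i), tri (e i) = b & e i + 2 <= n]) /\
    (forall i j, i < j -> j <= N -> e i + 3 <= e j).
Proof.
pose f x : 'I_3 * bool := (inord (x %% 3), tri x).
rewrite (_ : 6 = #|{: 'I_3 * bool}|); last by rewrite card_prod card_ord card_bool.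
case/(@count_pigeonhole _ f) => -[c b]; set ev' := (fun x => _).
rewrite -size_filter => szE; set E := filter _ _ in szE.
have sE : sorted ltn E by apply: sorted_filter (iota_ltn_sorted _ _); apply: ltn_trans.
have memE i : i <= N.+1 -> nth 0 E i \in E by move=> iN; rewrite mem_nth // (leq_ltn_trans iN).
have PE i : i <= N.+1 -> [/\ ev (nth 0 E i), tri (nth 0 E i) = b,
    nth 0 E i < n & nth 0 E i %% 3 = c].
  move/memE; rewrite mem_filter mem_iota => /andP[/andP[evi /eqP[Ec Eb]] lt].
  by split=> //; rewrite -Ec inordK // ltn_mod.
have spaced i j : i < j -> j <= N.+1 -> nth 0 E i + 3 <= nth 0 E j.
  move=> ij jN; have iN : i <= N.+1 by apply: leq_trans (ltnW ij) jN.
  have lt : nth 0 E i < nth 0 E j.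
    by apply: (sorted_ltn_nth ltn_trans 0 sE); rewrite ?inE //; apply: leq_ltn_trans szE.
  have [_ _ _ Ei] := PE i iN; have [_ _ _ Ej] := PE j jN.
  move: lt Ei Ej; move: (nth 0 E i) (nth 0 E j) (nat_of_ord c) => x y z; lia.
exists (nth 0 E), b; split.
  move=> i iN; have [? ? _ _] := PE i (leqW iN); split=> //.
  (* The class has one event more than needed; it lies below [n], which leaves room on the path
     after each earlier event. *)
  have [_ _ lt _] := PE N.+1 (leqnn _); have := spaced i N.+1 iN (leqnn _); lia.
by move=> i j ij jN; apply: spaced => //; apply: leqW.
Qed.

(** With each edge of a comb named by its end away from the left end of the spine, these are the
    spine edge and the tooth edge that leave the same spine vertex. They are adjacent in the line
    graph but not under [comb_adj]. *)
Definition sibling (p q : nat * nat) : bool :=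
  [&& p.2 == 0, q.2 == 1 & p.1 == q.1.+1] ||
  [&& q.2 == 0, p.2 == 1 & q.1 == p.1.+1].

Lemma sibling_sym : symmetric sibling.
Proof. by move=> p q; apply: orbC. Qed.

(** All teeth get the common height [M]; shorter ones are obtained later by restriction. *)
Definition in_comb (a : nat -> nat) (N M x j : nat) : Prop :=
  a 0 <= x <= a N /\ (j = 0 \/ j <= M /\ exists2 i, i <= N & x = a i).

(* With [b] false, [tau] embeds a comb; with [b] true, each tooth is attached
   by a triangle, as in the line graph of a comb. *)
Definition comb_embedding (G : sgraph) (b : bool) (a : nat -> nat) (N M : nat)
    (tau : nat -> nat -> G) : Prop :=
  (forall i j, i < j -> j <= N -> a i < a j) /\
  forall x j y l, in_comb a N M x j -> in_comb a N M y l ->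
    (tau x j = tau y l -> (x, j) = (y, l)) /\
    adj (tau x j) (tau y l) =
      comb_adj (x, j) (y, l) || b && sibling (x, j) (y, l).

Section Assembly.

Variables (G : sgraph) (H : {set G}) (d : G -> nat) (p : nat -> G) (n N M : nat).
Variables (e : nat -> nat) (w : nat -> G) (on : nat -> bool) (b : bool).
Variables (D : nat -> {set G}) (g : nat -> nat -> G).
Hypothesis d_lip : {in H &, forall y z, adj y z -> d z <= (d y).+1}.
Hypothesis pH : forall x, x <= n -> p x \in H /\ d (p x) = x.
Hypothesis pa : forall x, x < n -> adj (p x) (p x.+1).
Hypothesis e_n : forall i, i <= N -> e i + 2 <= n.
Hypothesis e_sp : forall i j, i < j -> j <= N -> e i + 3 <= e j.
Hypothesis w_on : forall i, i <= N -> on i -> w i = p (e i).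
Hypothesis w_off : forall i, i <= N -> ~~ on i ->
  [/\ w i \in H, d (w i) = (e i).+1, adj (p (e i)) (w i) & w i != p (e i).+1].
Hypothesis D_p : forall i x, i <= N -> x <= n -> p x \notin D i.
Hypothesis D_w : forall i j, i <= N -> j <= N -> w j \notin D i.
Hypothesis D_nbr : forall i y z, i <= N -> y \in D i -> z \in H -> adj y z ->
  z \notin D i -> z = w i.
Hypothesis U_anti : forall i j y z, i <= N -> j <= N -> i != j ->
  y \in w i |: D i -> z \in w j |: D j -> y != z /\ ~~ adj y z.
Hypothesis g0 : forall i, i <= N -> g i 0 = w i.
Hypothesis gU : forall i j, i <= N -> j <= M -> g i j \in w i |: D i.
Hypothesis gP : forall i j l, i <= N -> j <= M -> l <= M ->
  (g i j = g i l -> j = l) /\ adj (g i j) (g i l) = (j == l.+1) || (l == j.+1).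
Hypothesis triE : forall i, i <= N ->
  [&& ~~ on i, adj (w i) (p (e i).+1) & ~~ adj (w i) (p (e i).+2)] = b.

(* A pendant attached to both neighbours of [p (e i).+1] replaces that vertex. *)
Definition shifted i := ~~ on i && adj (w i) (p (e i).+2).
Definition junction i := e i + shifted i.
Definition spine x :=
  if [pick i : 'I_N.+1 | shifted i && (junction i == x)] is Some i then w i else p x.
(** If [w i] is on the spine, the tooth begins with [g i 1]. Otherwise [w i], which is [g i 0], is
    the tooth vertex of height 1, and the index moves by one. *)
Definition tooth i j := if on i || shifted i then g i j else g i j.-1.
Definition comb_map x j :=
  if j == 0 then spine x else
  if [pick i : 'I_N.+1 | junction i == x] is Some i then tooth i j else p x.

Lemma junction_sp i j : i < j -> j <= N -> junction i + 2 <= junction j.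
Proof. by move=> ij jN; have := e_sp ij jN; rewrite /junction; lia. Qed.

Lemma junction_n i : i <= N -> junction i < n.
Proof. by move=> iN; have := e_n iN; rewrite /junction; lia. Qed.

Lemma junction_inj i j : i <= N -> j <= N -> junction i = junction j -> i = j.
Proof.
move=> iN jN E; case: (ltngtP i j) => // ij.
  by have := junction_sp ij jN; lia.
by have := junction_sp ij iN; lia.
Qed.

Lemma spineP x :
  (exists i, [/\ i <= N, shifted i, x = (e i).+1 & spine x = w i]) \/
  (forall i, i <= N -> shifted i -> x <> (e i).+1) /\ spine x = p x.
Proof.
rewrite /spine; case: pickP => [i /andP[si /eqP E]|no]; [left|right].
  by exists i; rewrite si -E /junction si addn1 -ltnS.
split=> // i iN si E; have := no (Ordinal (iN : i < N.+1)).
by rewrite /= si /junction si addn1 E eqxx.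
Qed.

Lemma spine_shifted i : i <= N -> shifted i -> spine (e i).+1 = w i.
Proof.
move=> iN si; case: (spineP (e i).+1) => [[j [jN sj [E] ->]]|[no _]].
  congr w; case: (ltngtP i j) => // ij.
    by have := e_sp ij jN; lia.
  by have := e_sp ij iN; lia.
by case: (no i iN si).
Qed.

Lemma spine_near i x : i <= N -> e i <= x <= (e i).+2 ->
  (shifted i -> x <> (e i).+1) -> spine x = p x.
Proof.
move=> iN xI nx; case: (spineP x) => [[j [jN sj E _]]|[]//].
have [ij|ij] := eqVneq i j; first by rewrite -ij in sj E; case: (nx sj).
case: (ltngtP i j) ij => // ij _.
  by have := e_sp ij jN; lia.
by have := e_sp ij iN; lia.
Qed.

(** A replacing vertex [w i] has the level of the vertex it replaces, so the rerouted spine still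
    has one vertex per level and [level_path_adj] applies. *)
Lemma spine_level x : x <= n -> spine x \in H /\ d (spine x) = x.
Proof.
move=> xn; case: (spineP x) => [[i [iN /andP[oi _] -> ->]]|[_ ->]]; last exact: pH.
by have [] := w_off iN oi.
Qed.

Lemma spine_step x : x < n -> adj (spine x) (spine x.+1).
Proof.
move=> xn; case: (spineP x) => [[i [iN si E ->]]|[nx Ex]].
  rewrite (@spine_near i) //; last 2 first; try lia.
  by case/andP: si => _; rewrite E.
case: (spineP x.+1) => [[i [iN si [E] ->]]|[_ ->]]; last by rewrite Ex pa.
by rewrite Ex E; case/andP: si => oi _; have [] := w_off iN oi.
Qed.

Lemma spine_adj x y : x <= n -> y <= n ->
  adj (spine x) (spine y) = (x == y.+1) || (y == x.+1).
Proof. exact: level_path_adj d_lip spine_level spine_step x y. Qed.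

Lemma spine_inj x y : x <= n -> y <= n -> spine x = spine y -> x = y.
Proof.
move=> xn yn E; have [_ <-] := spine_level xn; rewrite E.
by have [_ ->] := spine_level yn.
Qed.

Lemma spine_D i x : i <= N -> x <= n -> spine x \notin D i.
Proof.
move=> iN xn; case: (spineP x) => [[j [jN _ _ ->]]|[_ ->]]; first exact: D_w.
exact: D_p.
Qed.

(** When [i] is neither [on] nor shifted, the spine carries [p (e i).+1] at the level of [w i], a
    different vertex. *)
Lemma spine_w i x : i <= N -> x <= n ->
  (spine x == w i) = (on i || shifted i) && (x == junction i).
Proof.
move=> iN xn; have en := e_n iN.
have [oi|oi] /= := boolP (on i).
  have si : shifted i = false by rewrite /shifted oi.
  rewrite (w_on iN oi) -(@spine_near i) ?si //; last by lia.
  apply/eqP/eqP => [/spine_inj->|->]; rewrite /junction ?si ?addn0 //; lia.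
have [si|si] /= := boolP (shifted i).
  rewrite -(spine_shifted iN si) /junction si addn1.
  by apply/eqP/eqP => [/spine_inj->|->] //; lia.
have [wH dw _ wp] := w_off iN oi; apply/eqP => E.
have [_] := spine_level xn; rewrite E dw => Ex.
by move: wp; rewrite -E -Ex (@spine_near i) ?eqxx //; try lia; rewrite (negbTE si).
Qed.

Lemma tooth_U i j : i <= N -> j <= M -> tooth i j \in w i |: D i.
Proof.
move=> iN jM; rewrite /tooth; case: ifP => _; apply: gU => //.
exact: leq_trans (leq_pred j) jM.
Qed.

Lemma spine_nbr_D i x y : i <= N -> x <= n -> y \in D i -> adj (spine x) y ->
  spine x = w i.
Proof.
move=> iN xn yD a; apply: (D_nbr iN yD); first by have [] := spine_level xn.
  by rewrite adj_sym.
exact: spine_D.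
Qed.

Lemma g_D i j : i <= N -> 0 < j -> j <= M -> g i j \in D i.
Proof.
move=> iN j0 jM; case/setU1P: (gU iN jM) => // E.
have [+ _] := gP iN jM (leq0n M); rewrite E g0 // => /(_ erefl) j0'.
by rewrite j0' in j0.
Qed.

(** If [w i] is on the spine, the tooth lies in [D i], which sees the spine only at [w i]. Otherwise
    the tooth starts at [w i], whose spine neighbours have levels [e i] to [(e i).+2]; the last is
    excluded since [i] is not shifted, and the middle one occurs exactly when [b] holds. *)
Lemma spine_tooth i x j : i <= N -> x <= n -> 0 < j -> j <= M ->
  spine x <> tooth i j /\
  adj (spine x) (tooth i j) =
    (j == 1) && ((x == junction i) || b && (x == (junction i).+1)).
Proof.
move=> iN xn j0 jM; have tri := triE iN; rewrite /tooth.
have [oi|oi] := boolP (on i || shifted i).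
  have gD := g_D iN j0 jM; split.
    by move=> E; have := spine_D iN xn; rewrite E gD.
  (* A triangle needs [w i] off the path and not adjacent to [p (e i).+2]. *)
  have -> : b = false.
    rewrite -tri; case/orP: oi => [->//|]; rewrite /shifted => /andP[-> ->].
    by rewrite !andbF.
  rewrite orbF; have [E|xi] := eqVneq x (junction i).
    have /eqP-> : spine x == w i by rewrite spine_w // oi E eqxx.
    by rewrite -(g0 iN); have [_ ->] := gP iN (leq0n M) jM; rewrite andbT.
  rewrite andbF; apply/negbTE/negP => /(spine_nbr_D iN xn gD) /eqP.
  by rewrite spine_w // (negbTE xi) andbF.
have Ns y : spine y <> w i \/ n < y.
  have [yn|] := leqP y n; [left|by right].
  by move/eqP; rewrite spine_w // (negbTE oi).
have nsw : spine x <> w i by case: (Ns x) => //; lia.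
(* From height 2 on the tooth lies in [D i], and its only possible spine neighbour [w i] is not on
   the spine. *)
have [j1|j1] := eqVneq j 1; last first.
  have gD : g i j.-1 \in D i by apply: g_D => //; lia.
  split; first by move=> E; have := spine_D iN xn; rewrite E gD.
  by apply/negbTE/negP => /(spine_nbr_D iN xn gD).
rewrite j1 /= g0 //; split=> //.
move: oi; rewrite negb_or => /andP[oi si].
have [wH dw pw wp] := w_off iN oi; have en := e_n iN.
have ad : ~~ adj (w i) (p (e i).+2) by move: si; rewrite /shifted oi.
rewrite oi ad andbT /= in tri.
rewrite /junction (negbTE si) addn0.
have near y : e i <= y <= (e i).+2 -> spine y = p y.
  by move=> yI; apply: (@spine_near i) => //; rewrite (negbTE si).
have [E|xe] := eqVneq x (e i); first by rewrite E near // leqnn leqW.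
have [E|xe1] := eqVneq x (e i).+1.
  by rewrite E near ?andbT ?leqnSn // adj_sym.
rewrite andbF; apply/negbTE/negP => a.
have [sH ds] := spine_level xn.
have := d_lip sH wH a; rewrite adj_sym in a; have := d_lip wH sH a.
rewrite ds dw => H1 H2; have E : x = (e i).+2 by clear -xe xe1 H1 H2; lia.
by move: ad; rewrite -near ?leqnn ?leqW // -E a.
Qed.

Lemma tooth_tooth i j l : i <= N -> 0 < j <= M -> 0 < l <= M ->
  (tooth i j = tooth i l -> j = l) /\
  adj (tooth i j) (tooth i l) = (j == l.+1) || (l == j.+1).
Proof.
move=> iN /andP[j0 jM] /andP[l0 lM]; rewrite /tooth; case: ifP => _.
  exact: gP.
have [||gi ga] := @gP i j.-1 l.-1 iN; try by rewrite (leq_trans (leq_pred _)).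
by split; [move/gi; clear -j0 l0; lia|rewrite ga; clear -j0 l0; lia].
Qed.

Lemma junction_pick i : i <= N ->
  [pick k : 'I_N.+1 | junction k == junction i] = Some (inord i).
Proof.
move=> iN; case: pickP => [k /eqP E|/(_ (inord i))]; last by rewrite inordK ?eqxx.
congr Some; apply: val_inj; rewrite /= inordK //; apply: junction_inj E => //.
by rewrite -ltnS.
Qed.

Lemma comb_map_tooth i j : i <= N -> 0 < j -> comb_map (junction i) j = tooth i j.
Proof.
by move=> iN j0; rewrite /comb_map gtn_eqF // junction_pick // inordK.
Qed.

(** Levels settle pairs on the spine, [spine_tooth] the mixed pairs, the induced path [g i] pairs in
    one tooth, and [U_anti] pairs in two teeth. *)
Lemma comb_map_embedding : comb_embedding b junction N M comb_map.
Proof.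
have mono i j : i < j -> j <= N -> junction i < junction j.
  by move=> ij jN; have := junction_sp ij jN; lia.
split=> //.
have xn x j : in_comb junction N M x j -> x <= n.
  by case=> xI _; have := junction_n (leqnn N); lia.
have cases x j : in_comb junction N M x j -> (j = 0 /\ comb_map x j = spine x) \/
    exists i, [/\ i <= N, 0 < j <= M, x = junction i & comb_map x j = tooth i j].
  move=> [xI H']; have [j0|j0] := posnP j; [left|right].
    by rewrite /comb_map j0 eqxx.
  case: H' => [E|[jM [i iN E]]]; first by rewrite E in j0.
  by exists i; rewrite E comb_map_tooth // j0 jM.
have mixed x i j : x <= n -> i <= N -> 0 < j <= M ->
    comb_map x 0 = spine x ->
    spine x <> tooth i j /\ adj (spine x) (tooth i j) =
      comb_adj (x, 0) (junction i, j) || b && sibling (x, 0) (junction i, j).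
  move=> x_n iN /andP[j0 jM] _; have [H1 ->] := spine_tooth iN x_n j0 jM.
  by split=> //; rewrite /comb_adj /sibling /=; case: b; lia.
move=> x j y l cx cy; have x_n := xn _ _ cx; have y_n := xn _ _ cy.
case: (cases x j cx) (cases y l cy) => [[-> Ex]|[i [iN jI Ex ->]]]
    [[-> Ey]|[i' [iN' lI Ey ->]]].
- rewrite Ex Ey; split; first by move/spine_inj => ->.
  by rewrite spine_adj // /comb_adj /sibling /=; case: b; lia.
- rewrite Ex Ey; have [H1 H2] := mixed x i' l x_n iN' lI Ex.
  by split=> [/H1|].
- rewrite Ey Ex; have [H1 H2] := mixed y i j y_n iN jI Ey.
  split=> [/esym/H1 //|]; rewrite adj_sym H2 comb_adj_sym.
  by rewrite sibling_sym.
- have [ii|ii] := eqVneq i i'.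
    rewrite Ex Ey -ii; have [H1 H2] := tooth_tooth iN jI lI.
    split; first by move/H1 => ->.
    by rewrite H2 /comb_adj /sibling /=; case: b; lia.
  case/andP: jI => j0 jM; case/andP: lI => l0 lM.
  have [H1 H2] := U_anti iN iN' ii (tooth_U iN jM) (tooth_U iN' lM).
  split=> [E|]; first by rewrite E eqxx in H1.
  rewrite (negbTE H2) Ex Ey.
  have jj : junction i != junction i'.
    by apply: contraNneq ii => /(junction_inj iN iN')->.
  by rewrite /comb_adj /sibling /=; case: b; lia.
Qed.

End Assembly.

(** * Combs in graphs with a creature *)

Lemma legged_ends_inj (G : sgraph) k (J : {set G}) (L : 'I_k -> {set G}) v :
  legged J L v -> injective v.
Proof.
move=> lJ i j E; apply/eqP; apply: contraT => ij.
have [] := leg_anticomplete lJ ij (leg_end lJ i) (leg_end lJ j).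
by rewrite E eqxx.
Qed.

Lemma minimal_connector (G : sgraph) k (J : {set G}) (v : 'I_k -> G) :
  conn J -> (forall i, exists2 y, y \in J & adj (v i) y) -> 0 < k ->
  exists H : {set G}, [/\ H \subset J :|: leg_ends v, leg_ends v \subset H, conn H
    & forall K : {set G}, leg_ends v \subset K -> K \subset H -> conn K -> K = H].
Proof.
case: k v => // k v cJ vJ _; pose X := leg_ends v.
have cJX : conn (J :|: X).
  have [y0 y0J _] := vJ ord0.
  have toy0 y : y \in J -> connect (within (J :|: X)) y y0.
    by move=> yJ; apply: (withinS (subsetUl _ _)); apply: connP.
  apply: (@conn_star _ _ y0) => y /setUP[/toy0 //|/imsetP[i _ ->]].
  have [z zJ vz] := vJ i; apply: connect_trans (toy0 z zJ); apply: connect1.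
  by rewrite /within vz !in_setU zJ imset_f ?orbT.
pose Q (A : {set G}) := [&& X \subset A, A \subset J :|: X & conn A].
have [|H /minsetP[/and3P[XH HJ cH] Hmin]] := @ex_minset _ Q.
  by exists (J :|: X); rewrite /Q subsetUr subxx.
exists H; split=> // K XK KH cK; apply: Hmin => //.
by rewrite /Q XK cK (subset_trans KH HJ).
Qed.

(** A leg is larger than a ball of radius [M], so each attachment starts an induced path of length
    [M] into its private part. The number of legs forces more than [6 * N.+1] events, from which
    [spaced_events] selects [N.+1] of one kind. *)
Lemma legged_comb (G : sgraph) Delta k (J : {set G}) (L : 'I_k -> {set G}) v N M :
  max_degree_le G Delta -> 0 < Delta -> conn J -> legged J L v ->
  (forall i, exists2 y, y \in J & adj (v i) y) ->
  (forall i, Delta.+1 ^ M < #|L i|) -> Delta.+1 ^ (6 * N.+1).+1 <= k ->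
  exists b a tau, @comb_embedding G b a N M tau.
Proof.
move=> degG D0 cJ lJ vJ bigL bigk.
have k0 : 0 < k by apply: leq_trans bigk; rewrite expn_gt0.
have [H [HJ XH cH Hmin]] := minimal_connector cJ vJ k0.
set X := leg_ends v in HJ XH Hmin.
have cardX : #|X| = k by rewrite card_imset ?card_ord //; apply: legged_ends_inj lJ.
pose r := v (Ordinal k0).
have rH : r \in H by apply: (subsetP XH); apply: imset_f.
have [d [dr dpar dlip]] := conn_levels cH rH.
pose R : rel G := fun u c => [&& adj u c, u \in H, c \in H & d c == (d u).+1].
have R_level u c : R u c -> d c = (d u).+1 by case/and4P=> _ _ _ /eqP.
have R_deg u : #|[set c | R u c]| <= Delta.
  apply: leq_trans (degG u); apply/subset_leq_card/subsetP => c.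
  by rewrite !inE => /and4P[].
(* Every vertex of [H] descends from the root, so all [k] leg ends are counted there. *)
have reach y : y \in H -> connect R r y.
  move En : (d y) => m; elim: m y En => [|m IH] y dy yH.
    have [->|yr] := eqVneq y r; first exact: connect0.
    by have [z _ [_]] := dpar y yH yr; rewrite dy.
  have yr : y != r by apply: contraTneq isT => yr; rewrite yr dr in dy.
  have [z zH [zy E]] := dpar y yH yr.
  apply: (@connect_trans _ _ z); first by apply: IH => //; move: E; rewrite dy => -[].
  by apply: connect1; rewrite /R zy zH yH E eqxx.
have [|n [p [p0 pR pc]]] := @branching_path _ R X d Delta R_level R_deg D0 (6 * N.+1).+1 r.
  rewrite (_ : descendants R X r = X) ?cardX //; apply/setP => x; rewrite inE.
  by apply: andb_idr => xX; apply: reach; apply: (subsetP XH).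
have pH x : x <= n -> p x \in H /\ d (p x) = x.
  elim: x => [|x IH] xn; first by rewrite p0.
  have [_ dx] := IH (ltnW xn).
  by have /and4P[_ _ -> /eqP->] := pR x xn; rewrite dx.
have pa x : x < n -> adj (p x) (p x.+1) by move/pR/and4P=> [].
pose P := [set p (nat_of_ord x) | x : 'I_n.+1].
have pP x : x <= n -> p x \in P.
  by move=> xn; apply/imsetP; exists (inord x); rewrite ?inordK.
have PP y : y \in P -> exists2 x, x <= n & y = p x.
  by case/imsetP=> x _ ->; exists x; rewrite // -ltnS ltn_ord.
have PH : P \subset H by apply/subsetP => y /PP[x xn ->]; case: (pH x xn).
have cP : conn P.
  apply: (@conn_star _ _ (p 0)) => y /PP[x xn ->{y}].
  elim: x xn => [|x IH] xn; first exact: connect0.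
  apply: connect_trans (IH (ltnW xn)); apply: connect1.
  by rewrite /within adj_sym pa // !pP // ltnW.
pose on x := p x \in X.
(* At a leg end the attachment is the path vertex itself, otherwise a second child; the default
   [p x] is never taken at an event. *)
pose w x := if on x then p x else
  odflt (p x) [pick w | R (p x) w && (w != p x.+1)].
pose tri x := [&& ~~ on x, adj (w x) (p x.+1) & ~~ adj (w x) (p x.+2)].
have [e [b [eP e_sp]]] := @spaced_events (branch_event R X p) tri n N pc.
have w_on x : on x -> w x = p x by rewrite /w => ->.
have w_off i : i <= N -> ~~ on (e i) ->
    R (p (e i)) (w (e i)) /\ w (e i) != p (e i).+1.
  move=> iN oi; have [+ _ _] := eP i iN; rewrite /branch_event -/(on _) (negbTE oi) /=.
  rewrite /w (negbTE oi); case: pickP => [w' /andP[] //|no /existsP[w' H']].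
  by have := no w'; rewrite H'.
have en i : i <= N -> e i + 2 <= n by case/eP.
have e_le i : i <= N -> e i <= n.
  by move=> iN; apply: leq_trans (leq_addr 2 _) (en i iN).
have wH i : i <= N -> w (e i) \in H.
  move=> iN; have [oi|oi] := boolP (on (e i)).
    by rewrite w_on //; have [] := pH _ (e_le i iN).
  by have [/and4P[]] := w_off i iN oi.
have dw i : i <= N -> d (w (e i)) = e i + ~~ on (e i).
  move=> iN; have [_ dp] := pH _ (e_le i iN).
  have [oi|oi] := boolP (on (e i)); first by rewrite w_on // dp addn0.
  by have [/and4P[_ _ _ /eqP->] _] := w_off i iN oi; rewrite dp addn1.
(* The path has a single vertex at the level of a second child, namely [p (e i).+1]. *)
have wP i : i <= N -> (w (e i) \in X) || (w (e i) \notin P).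
  move=> iN; have [oi|oi] := boolP (on (e i)); first by rewrite w_on // -/(on _) oi.
  apply/orP; right; apply/negP => /PP[x xn E]; have := dw i iN.
  rewrite oi addn1 E; have [_ ->] := pH x xn => Ex.
  by have [_] := w_off i iN oi; rewrite E Ex eqxx.
pose Z := with_legs H L.
have cZ : conn Z := with_legs_conn lJ XH cH.
have HZ : H \subset Z := subsetUl _ _.
have PZ : P \subset Z := subset_trans PH HZ.
have wZ i : i <= N -> w (e i) \in Z by move=> iN; apply: (subsetP HZ); apply: wH.
pose D y := private Z P y.
(* Attachments have level [e i] or [(e i).+1], so a gap of 3 between events leaves at least 2
   between their levels. *)
have dist i j : i <= N -> j <= N -> i != j ->
    [/\ e i != e j, w (e i) != w (e j), ~~ adj (w (e i)) (w (e j))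
      & p (e j) != w (e i)].
  move=> iN jN ij.
  have far : e i + 3 <= e j \/ e j + 3 <= e i.
    by case: (ltngtP i j) ij => // ij _; [left|right]; apply: e_sp.
  have [pjH dpj] := pH _ (e_le j jN).
  have dwi := dw i iN; have dwj := dw j jN; split.
  - by apply: contraTneq isT => E; move: far; rewrite E; clear; lia.
  - by apply/eqP => /(congr1 d); rewrite dwi dwj; move: (on (e i)) (on (e j)) far => [] []; clear; lia.
  - apply/negP => a; have := dlip _ _ (wH i iN) (wH j jN) a.
    rewrite adj_sym in a; have := dlip _ _ (wH j jN) (wH i iN) a.
    by rewrite dwi dwj; move: (on (e i)) (on (e j)) far => [] []; clear; lia.
  - by apply/eqP => /(congr1 d); rewrite dwi dpj; move: (on (e i)) far => []; clear; lia.
(* [w (e j)] equals or meets [p (e j)], which differs from [w (e i)]; hence it reaches the path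
   without [w (e i)]. *)
have D_w i j : i <= N -> j <= N -> w (e j) \notin D (w (e i)).
  move=> iN jN; have [->|ij] := eqVneq i j; first exact: private_self.
  have [_ wij _ pw] := dist i j iN jN ij.
  apply: (@private_near _ _ _ PZ _ _ (p (e j))) => //; first exact: wZ.
  - by rewrite eq_sym.
  - by apply: pP; apply: e_le.
  have [oj|oj] := boolP (on (e j)); first by left; apply: w_on.
  by right; rewrite adj_sym; have [/and4P[]] := w_off j jN oj.
(* A whole leg in [y |: D y] makes that set large enough for [conn_geodesic]. The constant function
   is a dummy for vertices that cannot be attachments. *)
have pendant y : exists g : nat -> G, y \in H -> (y \in X) || (y \notin P) ->
    [/\ g 0 = y, forall j, j <= M -> g j \in y |: D y
      & forall j l, j <= M -> l <= M -> (g j = g l -> j = l) /\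
          adj (g j) (g l) = (j == l.+1) || (l == j.+1)].
  have [yH|] := boolP (y \in H); last by exists (fun=> y).
  have [yP|] := boolP ((y \in X) || (y \notin P)); last by exists (fun=> y).
  have [i Li] := private_leg lJ HJ XH Hmin PH cP yH yP.
  have [|||l lP] := @conn_geodesic G (y |: D y) y Delta M degG.
  - by apply: private_conn => //; apply: (subsetP HZ).
  - exact: setU11.
  - by apply: leq_trans (bigL i) _; apply: subset_leq_card.
  by exists l.
have [g gspec] := fin_all_exists pendant.
pose we i := w (e i).
exists b, (junction p e we (on \o e)),
  (comb_map p N e we (on \o e) (g \o we)).
have gi i : i <= N -> _ := fun iN => gspec (we i) (wH i iN) (wP i iN).
apply: (@comb_map_embedding G H d p n N M e we (on \o e) b (D \o we) (g \o we)) => //.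
- by move=> i iN; apply: w_on.
- move=> i iN oi; have [/and4P[apw _ wiH /eqP dwi] ne] := w_off i iN oi; split=> //.
  by rewrite /we dwi; have [_ ->] := pH _ (e_le i iN).
- by move=> i x iN xn; apply: private_path; apply: pP.
- move=> i y z iN yD zH yz zD; apply/eqP; apply: contraR zD => zw.
  by apply: private_closed yD (subsetP HZ _ zH) zw yz.
- move=> i j y z iN jN ij; have [_ wij nadj _] := dist i j iN jN ij.
  exact: (private_anticomplete cZ (wZ i iN) (wZ j jN) wij
    (D_w j i jN iN) (D_w i j iN jN) nadj).
- by move=> i /gi[].
- by move=> i j iN; have [_ + _] := gi i iN; apply.
- by move=> i j l iN; have [_ _] := gi i iN; apply.
- by move=> i iN; have [_ + _] := eP i iN.
Qed.

Lemma creature_legged (G : sgraph) k t (J : {set G}) (P : 'I_k -> seq G) :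
  creature t J P ->
  exists v, [/\ conn J, legged J (fun i => [set x in P i]) v,
    forall i, exists2 y, y \in J & adj (v i) y
    & forall i, #|[set x in P i]| = t.+1].
Proof.
case=> -[_ cJ] [Ppath Pdisj Pdisj2 Panti Pend].
have [v vP] := fin_all_exists Pend; exists v; split.
- apply/connP => x y xJ yJ.
  have /connectP[p pp pE] := cJ (Sub x xJ) (Sub y yJ).
  have -> : y = last x (map val p) by rewrite -[x]/(val (Sub x xJ : {x | x \in J})) last_map -pE.
  apply/connectP; exists (map val p) => //.
  rewrite -[x]/(val (Sub x xJ : {x | x \in J})) path_map.
  apply: sub_path pp => a b ab; apply/and3P; split; [exact: ab|exact: valP|exact: valP].
- split.
  + move=> i; have [[[s' E]|[s' E]] _ _] := vP i; rewrite inE E ?mem_rcons mem_head //.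
  + move=> i; have [[[_ _ sP] _] _] := Ppath i.
    case: (P i) sP => [|x s] /= sP; first by apply/connP => y; rewrite inE.
    apply: (@conn_star _ _ x) => y yP; rewrite within_sym.
    have sub : {subset x :: s <= [set z in x :: s]} by move=> z zs; rewrite inE.
    move: yP; rewrite in_set in_cons => /predU1P[->|]; first exact: connect0.
    have H : path (within [set z in x :: s]) x s.
      move: sP sub; move: [set z in x :: s] => B.
      elim: s x => //= z s IH x /andP[xz zs] sub.
      rewrite /within xz !sub ?mem_head ?inE ?eqxx ?orbT //=.
      by apply: IH zs _ => u us; apply: sub; rewrite inE us orbT.
    move=> ys; apply: path_connect H _ _; exact: mem_behead.
  + move=> i y yP; apply/negP => yJ; have := Pdisj i.
    by move/disjoint_setI0/setP/(_ y); rewrite !inE yJ andbT; rewrite inE in yP; rewrite yP.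
  + move=> i y z yP yv zJ; have [_ _ H] := vP i; apply: H => //.
    by rewrite in_setD1 yv.
  + move=> i j y z ij yP zP; split; last exact: (Panti i j ij).
    apply/eqP => E; have := Pdisj2 i j ij.
    by move/disjoint_setI0/setP/(_ y); rewrite in_setI yP E zP inE.
- by move=> i; have [_ H _] := vP i.
- by move=> i; have [[[_ uP _] _] sP] := Ppath i; rewrite cardsE (card_uniqP uP).
Qed.

(** * Embedding stretched combs *)

(** The comb is rooted at the left end of its spine: parents lie below in a tooth and to the left on
    the spine. *)
Definition comb_parent (p : nat * nat) : nat * nat :=
  if p.2 == 0 then (p.1.-1, 0) else (p.1, p.2.-1).

Lemma comb_adj_parent m p q : m <= p.1 -> m <= q.1 ->
  comb_adj p q =
    (p != (m, 0)) && (comb_parent p == q) || (q != (m, 0)) && (comb_parent q == p).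
Proof.
case: p q => [x [|j]] [y [|l]]; rewrite /comb_adj /comb_parent /= !xpair_eqE /=; lia.
Qed.

(** Two children of one comb vertex can only be the next spine vertex and the first tooth vertex,
    the pairs that [sibling] adds. *)
Lemma comb_adj_sibling m p q : m <= p.1 -> m <= q.1 -> p != (m, 0) -> q != (m, 0) ->
  comb_adj p q || sibling p q =
    [|| comb_parent p == q, comb_parent q == p
      | (p != q) && (comb_parent p == comb_parent q)].
Proof.
case: p q => [x [|j]] [y [|l]];
  rewrite /comb_adj /sibling /comb_parent /= !xpair_eqE /=; lia.
Qed.

Section CombInGraph.

Variables (G : sgraph) (N M : nat) (a h : nat -> nat) (tau : nat -> nat -> G).
Hypothesis a_lt : forall i j, i < j -> j <= N -> a i < a j.
Hypothesis h_le : forall i, i <= N -> h i <= M.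

Lemma scomb_in_comb (u : scomb N a h) : in_comb a N M (val u).1 (val u).2.
Proof.
case: u => -[x j] /= us; have := us; rewrite mem_comb_seq // => /andP[xI jh].
split=> //; have [j0|j0] := posnP j; [by left|right].
have [i iN E] := tooth_height_gt0 (leq_trans j0 jh).
split; last by exists i.
by apply: leq_trans jh _; rewrite E tooth_heightE // h_le.
Qed.

Lemma scomb_contains :
  comb_embedding false a N M tau -> contains_induced G (scomb N a h).
Proof.
case=> _ Ht; apply: (@contains_induced_emb _ _ (fun u : scomb N a h => tau (val u).1 (val u).2)) => u v.
  have [H _] := Ht _ _ _ _ (scomb_in_comb u) (scomb_in_comb v).
  by move/H => E; apply: val_inj; rewrite [LHS]surjective_pairing E -surjective_pairing.
have [_ ->] := Ht _ _ _ _ (scomb_in_comb u) (scomb_in_comb v).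
by rewrite -!surjective_pairing orbF.
Qed.

(** The image of a vertex stands for the edge to its parent, so the image of the root is left out.
    The sum of the coordinates decreases towards the root and serves as level. *)
Lemma scomb_line_contains :
  comb_embedding true a N M tau -> contains_induced G (line_graph (scomb N a h)).
Proof.
case=> _ Ht; pose F := scomb N a h; pose r : F := scomb_root h a_lt.
pose par (u : F) : F := insubd r (comb_parent (val u)).
have rootP (u : F) : (u == r) = (val u == (a 0, 0)) by [].
have range (u : F) : a 0 <= (val u).1 by have [] := scomb_in_comb u; lia.
have parE u : u != r -> val (par u) = comb_parent (val u).
  move=> ur; rewrite val_insubd; case: ifP => // /negP[].
  have := range u; move: ur; rewrite rootP.
  case: (val u) (valP u) => x j /=; rewrite mem_comb_seq //.
  rewrite xpair_eqE /comb_parent /= => /andP[xI jh] ur a0x.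
  case: (j =P 0) ur => [j0 ur|j0 _]; rewrite mem_comb_seq //.
    by rewrite andbT; clear -xI ur; lia.
  by rewrite xI (leq_trans (leq_pred j)).
apply: (@contains_line_graph_rooted _ _ par r (fun u => (val u).1 + (val u).2)
  (fun u => tau (val u).1 (val u).2)).
- move=> u ur; rewrite parE //; move: ur (range u); rewrite rootP.
  by case: (val u) => x [|j]; rewrite /comb_parent xpair_eqE /=; clear; lia.
- move=> u v.
  have e1 : (u != r) && (par u == v) = (u != r) && (comb_parent (val u) == val v).
    by case: eqP => //= /eqP ur; rewrite -(inj_eq val_inj) parE.
  have e2 : (v != r) && (par v == u) = (v != r) && (comb_parent (val v) == val u).
    by case: eqP => //= /eqP ur; rewrite -(inj_eq val_inj) parE.
  by rewrite e1 e2; apply: comb_adj_parent; apply: range.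
- move=> u v _ _; have [H _] := Ht _ _ _ _ (scomb_in_comb u) (scomb_in_comb v).
  by move/H => E; apply: val_inj; rewrite [LHS]surjective_pairing E -surjective_pairing.
- move=> u v ur vr; have [_ ->] := Ht _ _ _ _ (scomb_in_comb u) (scomb_in_comb v).
  rewrite -!surjective_pairing -!(inj_eq val_inj) !parE //.
  by apply: comb_adj_sibling => //; apply: range.
Qed.

End CombInGraph.

Theorem theorem6p4 (T : sgraph) (hT : subdivided_caterpillar T)
    (hT3 : subcubic T) (Delta : nat) (hDelta : 0 < Delta) :
  exists k t : nat, 0 < k /\
    forall G : sgraph, max_degree_le G Delta -> contains_creature G k t ->
      exists F : sgraph, subdivision T F /\
        (contains_induced G F \/ contains_induced G (line_graph F)).
Proof.
have [co [N [h [co_inj co_dom co_surj co_adj]]]] := comb_coordinates hT hT3.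
pose M := \max_(i < N.+1) h i.
have h_le i : i <= N -> h i <= M.
  by move=> iN; apply: (@leq_bigmax _ (fun k : 'I_N.+1 => h k) (Ordinal (iN : i < N.+1))).
(* A leg has [t.+1] vertices, one more than the bound on a ball of radius [M], the greatest tooth
   height; [k] is the number of legs required by [legged_comb]. *)
exists (Delta.+1 ^ (6 * N.+1).+1), (Delta.+1 ^ M); split; first by rewrite expn_gt0.
move=> G degG [J [P /creature_legged[v [cJ lJ vJ szL]]]].
have [|//|b [a [tau emb]]] := legged_comb degG hDelta cJ lJ vJ (N := N) (M := M).
  by move=> i; rewrite szL.
exists (scomb N a h); split.
  by apply: scomb_subdivision co_inj co_dom co_surj co_adj; case: emb.
(* Teeth attached by triangles give the line graph, the others the comb itself. *)
have [a_lt _] := emb; case: b emb => emb; [right|left].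
  exact: scomb_line_contains a_lt h_le emb.
exact: scomb_contains a_lt h_le emb.
Qed.
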